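(* Let $p_{Y|X}$ (receiver channel) and $p_{W|X}$ (detector channel) be memoryless channels with common input alphabet $\mathcal{X}$, $x_0\in\mathcal{X}$ the innocent symbol, and $p_{\tilde X}$ a kernel density on $\mathcal{X}$ with $0<\chi^2(p_{\tilde W}\parallel p_{W|X=x_0})<\infty$, where $p_{\tilde W}(w)=\int_{\mathcal{X}}p_{\tilde X}(x)p_{W|X}(w|x)\,dx$. Let $\epsilon_{\rm det},\epsilon_{\rm dec}\in(0,1)$ be fixed and $\xi=e^{-\frac12\mathsf{W}_0(4\epsilon_{\rm det}^2)}$. For each (sufficiently large) $n$ suppose the transmitter uses the sparse signalling density $$p_X(x)=(1-\tau)\delta(x-x_0)+\tau p_{\tilde X}(x),\qquad\tau=\frac{2\xi\epsilon_{\rm det}}{\sqrt{n\,\chi^2(p_{\tilde W}\parallel p_{W|X=x_0})}}.$$ Then there exist codes with $M=M_n$ code words of length $n$ (from the ensemble of codes with i.i.d. $p_X$ letters), with average decoding error probability not exceeding $\epsilon_{\rm dec}$ and probability of detection not exceeding $\epsilon_{\rm det}$, such that $$\liminf_{n\to\infty}\frac{\log_2M_n}{\epsilon_{\rm det}\sqrt n}\ \ge\ \frac{2\xi}{\log2}\,\frac{I(\tilde X;Y)}{\sqrt{\chi^2(p_{\tilde W}\parallel p_{W|X=x_0})}},$$ where $I(\tilde X;Y)$ is the mutual information (in nats) between $\tilde X\sim p_{\tilde X}$ and the output $Y$ of the channel $p_{Y|X}$ with input $\tilde X$.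
   Context: $\log$ is the natural logarithm, $\delta$ the Dirac delta, $\mathsf{W}_0$ the principal branch of the Lambert W function, and $\chi^2(p\parallel q)=\int\frac{(p-q)^2}{q}$ the chi-squared distance. $I(X;Y)=\int\int p_{XY}(x,y)\log\frac{p_{XY}(x,y)}{p_X(x)p_Y(y)}\,dy\,dx$. Setting: a code is a list of $M$ code words in $\mathcal{X}^n$; in the ensemble, code words are generated independently with i.i.d. letters of distribution $p_X$. Messages are equally likely; message $m$ is sent by transmitting its code word over $n$ independent uses of $p_{Y|X}$, the receiver knows the code, and a decoding error occurs when the decoded message differs from $m$; the average is over messages. The detector does not know the code, only $p_X$, and tests from $\boldsymbol{w}\in\mathcal{W}^n$ the hypothesis $\mathcal{H}_0$: density $\prod_i p_{W|X}(w_i|x_0)$ (no transmission) against $\mathcal{H}_1$: density $\prod_i p_W(w_i)$ with $p_W(w)=\int p_X(x)p_{W|X}(w|x)\,dx$. With $\alpha,\beta$ the false and miss detection probabilities, ''probability of detection not exceeding $\epsilon_{\rm det}$'' means that the test minimising $\alpha+\beta$ satisfies $\alpha+\beta\ge1-\epsilon_{\rm det}$. Standing assumptions: $p_W$ is dominated by $p_{W|X=x_0}$ and $p_Y$ (with $p_Y(y)=\int p_X(x)p_{Y|X}(y|x)\,dx$) is dominated by $p_{Y|X=x_0}$, i.e. each vanishes wherever the dominating density vanishes. *)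

(* Defs.v *)
From HB Require Import structures.
From mathcomp Require Import all_boot all_order all_algebra.
From mathcomp Require Import all_classical all_reals all_analysis.

Set Implicit Arguments.
Unset Strict Implicit.
Unset Printing Implicit Defensive.
Import Order.TTheory GRing.Theory Num.Theory.
Import numFieldNormedType.Exports.

Local Open Scope classical_set_scope.
Local Open Scope ring_scope.

(* The product measure mu^n on n.-tuple T, built one letter at a time by
   transporting mu \x mu^n along the bijection (x, t) |-> x :: t. *)

Definition tuple_cons d (T : measurableType d) (n : nat)
  (z : T * n.-tuple T) : n.+1.-tuple T := [tuple of z.1 :: z.2].

Lemma measurable_tuple_cons d (T : measurableType d) (n : nat) :
  measurable_fun [set: T * n.-tuple T] (@tuple_cons d T n).
Proof. exact: (measurable_cons measurable_fst measurable_snd). Qed.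

HB.instance Definition _ d (T : measurableType d) (n : nat) :=
  isMeasurableFun.Build _ _ _ _ (@tuple_cons d T n)
    (@measurable_tuple_cons d T n).

Definition tuple_uncons d (T : measurableType d) (n : nat)
  (t : n.+1.-tuple T) : T * n.-tuple T := (thead t, [tuple of behead t]).

Lemma measurable_tuple_uncons d (T : measurableType d) (n : nat) :
  measurable_fun [set: n.+1.-tuple T] (@tuple_uncons d T n).
Proof.
apply/measurable_fun_pairP; split.
  exact: (@measurable_tnth _ T n.+1 ord0).
exact: measurable_behead.
Qed.

Lemma tuple_consK d (T : measurableType d) (n : nat) :
  cancel (@tuple_cons d T n) (@tuple_uncons d T n).
Proof. by move=> [x t]; congr pair; apply: val_inj. Qed.

Definition tuple_consm d (T : measurableType d) (R : realType) (n : nat)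
    (mu : {sigma_finite_measure set T -> \bar R})
    (nu : {sigma_finite_measure set (n.-tuple T) -> \bar R}) :
    set (n.+1.-tuple T) -> \bar R :=
  pushforward (mu \x nu)%E (@tuple_cons d T n).

Section tuple_consm.
Context d (T : measurableType d) (R : realType) (n : nat).
Variables (mu : {sigma_finite_measure set T -> \bar R})
  (nu : {sigma_finite_measure set (n.-tuple T) -> \bar R}).

Let tuple_consm0 : tuple_consm mu nu set0 = 0%E.
Proof. exact: measure0. Qed.

Let tuple_consm_ge0 A : (0 <= tuple_consm mu nu A)%E.
Proof. exact: measure_ge0. Qed.

Let tuple_consm_sigma_additive : semi_sigma_additive (tuple_consm mu nu).
Proof. exact: measure_semi_sigma_additive. Qed.

HB.instance Definition _ := isMeasure.Build _ _ _ (tuple_consm mu nu)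
  tuple_consm0 tuple_consm_ge0 tuple_consm_sigma_additive.

Let tuple_consm_sigma_finite : sigma_finite setT (tuple_consm mu nu).
Proof.
have /sigma_finiteP[F [TF ndF Foo]] := sigma_finiteT mu.
have /sigma_finiteP[G [TG ndG Goo]] := sigma_finiteT nu.
exists (fun i => @tuple_uncons d T n @^-1` (F i `*` G i)).
  rewrite predeqE => t; split=> // _.
  have [i _ Fi] : (\bigcup_i F i) (tuple_uncons t).1 by rewrite -TF.
  have [j _ Gj] : (\bigcup_i G i) (tuple_uncons t).2 by rewrite -TG.
  exists (maxn i j) => //; split => /=.
    by move: Fi; exact/subsetPset/ndF/leq_maxl.
  by move: Gj; exact/subsetPset/ndG/leq_maxr.
move=> i; have [mF Fi] := Foo i; have [mG Gi] := Goo i; split.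
  rewrite -[X in measurable X]setTI.
  exact: (@measurable_tuple_uncons d T n measurableT _ (measurableX mF mG)).
rewrite /tuple_consm /pushforward -comp_preimage.
rewrite (_ : _ \o _ = id) ?preimage_id; last first.
  by apply/funext => z /=; rewrite tuple_consK.
by rewrite product_measure1E// lte_mul_pinfty// ge0_fin_numE.
Qed.

HB.instance Definition _ := Measure_isSigmaFinite.Build _ _ _
  (tuple_consm mu nu) tuple_consm_sigma_finite.
End tuple_consm.

Fixpoint tuple_measure d (T : measurableType d) (R : realType)
    (mu : {sigma_finite_measure set T -> \bar R}) (n : nat) :
    {sigma_finite_measure set (n.-tuple T) -> \bar R} :=
  match n with
  | 0 => @dirac _ (0.-tuple T) [tuple] R
  | m.+1 => tuple_consm mu (tuple_measure mu m)
  end.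

(* Densities are taken with respect to arbitrary sigma-finite reference
   measures, which covers both discrete and continuous alphabets. *)

Definition is_density d (T : measurableType d) (R : realType)
    (mu : {sigma_finite_measure set T -> \bar R}) (p : T -> R) : Prop :=
  [/\ measurable_fun setT p, (forall x, 0 <= p x)
    & (\int[mu]_x (p x)%:E = 1)%E].

(* [q x y] is the conditional density of the output y given the input x. *)
Definition is_channel dX dY (X : measurableType dX) (Y : measurableType dY)
    (R : realType) (muY : {sigma_finite_measure set Y -> \bar R})
    (q : X -> Y -> R) : Prop :=
  measurable_fun setT (fun z : X * Y => q z.1 z.2) /\
  forall x, is_density muY (q x).

(* Output densities are real-valued: the real-valued integral is 0 at the
   points, forming a null set, where the integral diverges. *)
Definition output_density dX dY (X : measurableType dX)
    (Y : measurableType dY) (R : realType)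
    (mu : {sigma_finite_measure set X -> \bar R}) (p : X -> R)
    (q : X -> Y -> R) (y : Y) : R :=
  \int[mu]_x (p x * q x y).

(* Same as [output_density], for an input law that need not have a density. *)
Definition output_density_law dX dY (X : measurableType dX)
    (Y : measurableType dY) (R : realType) (P : probability X R)
    (q : X -> Y -> R) (y : Y) : R :=
  \int[P]_x (q x y).

Definition dominated_density (T : Type) (R : realType) (p q : T -> R) : Prop :=
  forall t, q t = 0 -> p t = 0.

(* Since _ / 0 = 0, this is the chi-squared distance only when p vanishes
   wherever q does. *)
Definition chi2 d (T : measurableType d) (R : realType)
    (mu : {sigma_finite_measure set T -> \bar R}) (p q : T -> R) : \bar R :=
  (\int[mu]_t ((p t - q t) ^+ 2 / q t)%:E)%E.

(* In nats; it may be +oo. The conventions ln 0 = 0 and _ / 0 = 0 only affect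
   points where the joint density vanishes, up to a null set. *)
Definition mutual_information dX dY (X : measurableType dX)
    (Y : measurableType dY) (R : realType)
    (muX : {sigma_finite_measure set X -> \bar R})
    (muY : {sigma_finite_measure set Y -> \bar R})
    (p : X -> R) (q : X -> Y -> R) : \bar R :=
  (\int[muX \x muY]_z
     (let pXY := p z.1 * q z.1 z.2 in
      pXY * ln (pXY / (p z.1 * output_density muX p q z.2)))%R%:E)%E.

(* Principal branch: the solution w >= -1 of w e^w = x, unique for
   x >= - e^-1; the value is 0 for other x. *)
Definition lambertW0 (R : realType) (x : R) : R :=
  xget 0 [set w : R | -1 <= w /\ w * expR w = x].

Definition log2 (R : realType) (x : R) : R := ln x / ln 2.

(* The law with density (1 - tau) delta(x - x0) + tau p(x). *)
Definition sparse_signalling d (X : measurableType d) (R : realType)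
    (mu : {sigma_finite_measure set X -> \bar R}) (x0 : X) (p : X -> R)
    (tau : R) (A : set X) : \bar R :=
  ((1 - tau)%:E * \d_x0 A + tau%:E * \int[mu]_(x in A) (p x)%:E)%E.

Definition product_density (T : Type) (R : realType) (n : nat)
    (p : T -> R) (t : n.-tuple T) : R :=
  \prod_(i < n) p (tnth t i).

Section Detection.
Context d (W : measurableType d) (R : realType).
Variables (mu : {sigma_finite_measure set W -> \bar R}) (p0 p1 : W -> R).

(* A test is the set D of observations on which it declares a transmission,
   the letters being i.i.d. with density p0 under H0 and p1 under H1. *)
Definition false_alarm (n : nat) (D : set (n.-tuple W)) : \bar R :=
  (\int[tuple_measure mu n]_(w in D) (product_density p0 w)%:E)%E.

Definition missed_detection (n : nat) (D : set (n.-tuple W)) : \bar R :=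
  (\int[tuple_measure mu n]_(w in ~` D) (product_density p1 w)%:E)%E.

Definition min_error_sum (n : nat) : \bar R :=
  ereal_inf [set (false_alarm D + missed_detection D)%E |
             D in [set D : set (n.-tuple W) | measurable D]].

Definition detection_prob_le (n : nat) (eps : R) : Prop :=
  ((1 - eps)%:E <= min_error_sum n)%E.
End Detection.

Definition codebook (X : Type) (M n : nat) : Type := M.-tuple (n.-tuple X).

Section Coding.
Context dX dY (X : measurableType dX) (Y : measurableType dY) (R : realType).
Variables (muY : {sigma_finite_measure set Y -> \bar R}) (q : X -> Y -> R).
Variables (M n : nat).

Definition is_decoder (dec : n.-tuple Y -> 'I_M) : Prop :=
  forall m, measurable [set y | dec y = m].

Definition error_prob (C : codebook X M n) (dec : n.-tuple Y -> 'I_M)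
    (m : 'I_M) : \bar R :=
  (\int[tuple_measure muY n]_(y in [set y | dec y <> m])
     (\prod_(i < n) q (tnth (tnth C m) i) (tnth y i))%R%:E)%E.

Definition average_error_prob (C : codebook X M n)
    (dec : n.-tuple Y -> 'I_M) : \bar R :=
  ((M%:R^-1)%:E * \sum_(m < M) error_prob C dec m)%E.

Definition decodable (eps : R) (C : codebook X M n) : Prop :=
  exists2 dec : n.-tuple Y -> 'I_M, is_decoder dec
    & (average_error_prob C dec <= eps%:E)%E.

(* All M * n letters are drawn independently from P. *)
Definition ensemble (P : probability X R) :
    set (M.-tuple (n.-tuple X)) -> \bar R :=
  tuple_measure (tuple_measure P n) M.

(* Codes with a given property that come from the ensemble: the property has
   nonzero probability under the ensemble (in particular such codes exist).
   Non-negligibility avoids requiring the property to be measurable. *)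
Definition exist_in_ensemble (P : probability X R)
    (good : codebook X M n -> Prop) : Prop :=
  ~ (ensemble P).-negligible [set C : M.-tuple (n.-tuple X) | good C].
End Coding.

(* Main.v *)
Require Import Defs.
From HB Require Import structures.
From mathcomp Require Import all_boot all_order all_algebra.
From mathcomp Require Import all_classical all_reals all_analysis.
From mathcomp Require Import measurable_realfun ring lra.

Set Implicit Arguments.
Unset Strict Implicit.
Unset Printing Implicit Defensive.
Import Order.TTheory GRing.Theory Num.Theory.
Import numFieldNormedType.Exports.

Local Open Scope classical_set_scope.
Local Open Scope ring_scope.

(* Detection. If L is the n-letter likelihood ratio of H1 against H0, then
   alpha + beta >= 1 - sqrt (E0 L^2 - 1) / 2, and E0 L^2 = (1 + tau^2 chi2)^n
   is at most e^w, where w := n tau^2 chi2 = 4 xi^2 eps_det^2. Since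
   xi^2 = e^-W0(4 eps_det^2), this w is W0(4 eps_det^2), so that
   e^w - 1 <= w e^w = 4 eps_det^2.

   Decoding. Let J := pXt q be the joint density of the kernel input and its
   output, qt := int pXt q the output density, and pY the output density under
   sparse signalling. Threshold decoding with the likelihoods q / pY and the
   threshold gam = e^(tau K2) per letter has expected error probability at most
   (int int P q^(1-s) (gam pY)^s)^n + M gam^-n. The innocent symbol contributes
   at most 1 - tau to int int P q^(1-s) pY^s by Young's inequality. For the
   kernel, q^(1-s) pY^s = q (qt / q)^s (pY / qt)^s, and since
   int int J (pY / qt) <= 1, AM-GM bounds its contribution by
   tau (1 + int int J (qt / q)^(2s)) / 2, uniformly in tau. By Fatou's lemma
   (1 - int int J (qt / q)^r) / r exceeds any K1 < I(Xt; Y) for some r > 0, so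
   the first term is at most e^(- n tau s (K1 - K2)) with s = r / 2. As
   n tau grows like sqrt n, every M = e^(n tau K) with K < K2 < K1 works. *)

(** * Products over tuples *)

Lemma emeasurable_prod d (T : measurableType d) (R : realType) (I : Type)
    (s : seq I) (D : set T) (f : I -> T -> \bar R) :
  (forall i, measurable_fun D (f i)) ->
  measurable_fun D (fun x => (\prod_(i <- s) f i x)%E).
Proof.
move=> mf; elim: s => [|i s IH].
  by under eq_fun do rewrite big_nil; exact: measurable_cst.
by under eq_fun do rewrite big_cons; exact: emeasurable_funM.
Qed.

Lemma ge0_integral_tuple_consm d (T : measurableType d) (R : realType) (n : nat)
    (mu : {sigma_finite_measure set T -> \bar R})
    (nu : {sigma_finite_measure set (n.-tuple T) -> \bar R})
    (f : n.+1.-tuple T -> \bar R) :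
  measurable_fun setT f -> (forall t, 0 <= f t)%E ->
  (\int[tuple_consm mu nu]_t f t =
   \int[mu]_x \int[nu]_t f [tuple of x :: t])%E.
Proof.
move=> mf f0.
rewrite /tuple_consm (ge0_integral_pushforward (@measurable_tuple_cons _ T n))//.
rewrite preimage_setT fubini_tonelli1//.
  exact: (measurableT_comp mf (@measurable_tuple_cons _ T n)).
by move=> z; exact: f0.
Qed.

(** Tonelli one letter at a time: by induction the integral over the tail is a constant, which
    leaves the integral over the head. The factors may depend on the position, so that one word can
    be frozen while the other is integrated. *)
Lemma integral_tuple_measure_prod d (T : measurableType d) (R : realType)
    (mu : {sigma_finite_measure set T -> \bar R}) (n : nat)
    (f : 'I_n -> T -> \bar R) :
  (forall i, measurable_fun setT (f i)) -> (forall i x, 0 <= f i x)%E ->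
  (\int[tuple_measure mu n]_t \prod_(i < n) f i (tnth t i) =
   \prod_(i < n) \int[mu]_x f i x)%E.
Proof.
elim: n f => [|n IH] f mf f0.
  rewrite big_ord0; under eq_integral do rewrite big_ord0.
  by rewrite integral_dirac//= diracT mul1e.
rewrite big_ord_recl/= ge0_integral_tuple_consm; last 2 first.
- apply: emeasurable_prod => i; apply: measurableT_comp => //.
  exact: measurable_tnth.
- by move=> t; exact: prode_ge0.
have mP : measurable_fun setT (fun t : n.-tuple T =>
    \prod_(i < n) f (lift ord0 i) (tnth t i))%E.
  by apply: emeasurable_prod => i; apply: measurableT_comp => //;
    exact: measurable_tnth.
transitivity (\int[mu]_x (f ord0 x * \prod_(i < n) \int[mu]_x f (lift ord0 i) x))%E.
  apply: eq_integral => x _; rewrite -IH// -ge0_integralZl//; last first.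
    by move=> t _; exact: prode_ge0.
  apply: eq_integral => t _; rewrite big_ord_recl/=; congr (_ * _)%E.
  by apply: eq_bigr => i _; rewrite (tnthS x t).
by rewrite ge0_integralZr//; apply: prode_ge0 => i _; exact: integral_ge0.
Qed.

Lemma integral_tuple_measure_expn d (T : measurableType d) (R : realType)
    (mu : {sigma_finite_measure set T -> \bar R}) (n : nat) (f : T -> \bar R) :
  measurable_fun setT f -> (forall x, 0 <= f x)%E ->
  (\int[tuple_measure mu n]_t \prod_(i < n) f (tnth t i) =
   (\int[mu]_x f x) ^+ n)%E.
Proof.
move=> mf f0; rewrite (@integral_tuple_measure_prod _ _ _ mu n (fun=> f))//.
by rewrite big_const card_ord iter_mule mule1.
Qed.

(** If [N] is null, the words whose [i]-th letter lies in [N] have as measure a product with one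
    zero factor. The other factors are [mu setT], possibly infinite, and 0 times +oo is 0. *)
Lemma tuple_measure_negligible d (T : measurableType d) (R : realType)
    (mu : {sigma_finite_measure set T -> \bar R}) (n : nat) (P : T -> Prop) :
  {ae mu, forall x, P x} ->
  {ae tuple_measure mu n, forall t, forall i : 'I_n, P (tnth t i)}.
Proof.
move=> [N [mN N0 PN]].
have ae1 (i : 'I_n) : {ae tuple_measure mu n, forall t, P (tnth t i)}.
  exists ((fun t => tnth t i) @^-1` N); split.
  - by rewrite -[X in measurable X]setTI; exact: measurable_tnth.
  - pose f k x := (if k == i then (\1_N x)%:E else 1)%E : \bar R.
    have mN' : measurable ((fun t : n.-tuple T => tnth t i) @^-1` N).
      by rewrite -[X in measurable X]setTI; exact: measurable_tnth.
    rewrite -[X in tuple_measure mu n X]setIT -integral_indic//.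
    transitivity (\int[tuple_measure mu n]_t \prod_(k < n) f k (tnth t k))%E.
      apply: eq_integral => t _; rewrite (bigD1 i)//= big1 ?mule1 /f ?eqxx//.
      by move=> k /negbTE ->.
    rewrite integral_tuple_measure_prod.
    + rewrite (bigD1 i)//= /f eqxx (_ : \int[mu]_x (\1_N x)%:E = 0)%E ?mul0e//.
      by rewrite integral_indic// setIT; exact: N0.
    + move=> k; rewrite /f; case: (k == i); last exact: measurable_cst.
      exact/measurable_EFinP.
    + by move=> k x; rewrite /f; case: ifP => // _; rewrite lee_fin.
  - by move=> t /= nP; apply: PN.
(* Countable intersection is indexed by [nat]; indices from [n] on contribute a vacuous
   condition. *)
have : {ae tuple_measure mu n, forall t, forall m, forall mn : (m < n)%N, P (tnth t (Ordinal mn))}.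
  apply/ae_foralln => m; have [mn|nm] : (m < n)%N \/ (n <= m)%N by case: ltnP; [left|right].
    apply: filterS (ae1 (Ordinal mn)) => t Pt mn'.
    by rewrite (bool_irrelevance mn' mn).
  by apply/aeW => t mn; exfalso; move: (mn); rewrite ltnNge nm.
by apply: filterS => t Pt [m mn]; exact: Pt.
Qed.

(** * Measures with a density *)

Section density_measure.
Context d (T : measurableType d) (R : realType).
Variables (mu : {measure set T -> \bar R}) (p : T -> R).
Hypotheses (mp : measurable_fun setT p) (p0 : forall x, 0 <= p x).

(* The unused hypotheses are arguments so that the measure structure can be
   attached to the head constant [density_measure]. *)
Definition density_measure (_ : measurable_fun setT p)
    (_ : forall x, 0 <= p x) (A : set T) : \bar R :=
  (\int[mu]_(x in A) (p x)%:E)%E.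

Local Notation nu := (density_measure mp p0).

Let density_measure0 : nu set0 = 0%E.
Proof. exact: integral_set0. Qed.

Let density_measure_ge0 A : (0 <= nu A)%E.
Proof. by apply: integral_ge0 => x _; rewrite lee_fin. Qed.

Let density_measure_sigma_additive : semi_sigma_additive nu.
Proof.
move=> F mF tF mUF; rewrite /density_measure ge0_integral_bigcup//.
- apply: is_cvg_nneseries => n _ _.
  by apply: integral_ge0 => x _; rewrite lee_fin.
- by apply/measurable_EFinP; exact: measurable_funTS.
- by move=> x _; rewrite lee_fin.
Qed.

HB.instance Definition _ := isMeasure.Build _ _ _
  (density_measure mp p0)
  density_measure0 density_measure_ge0 density_measure_sigma_additive.

Import HBNNSimple.

Let integral_density_measure_nnsfun (g : {nnsfun T >-> R}) :
  (\int[nu]_x (g x)%:E = \int[mu]_x ((g x)%:E * (p x)%:E))%E.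
Proof.
under [LHS]eq_integral do rewrite fimfunE -fsumEFin//.
rewrite ge0_integral_fsum//; last 2 first.
- by move=> y; exact/measurable_EFinP/measurable_funM.
- by move=> y x _; rewrite nnfun_muleindic_ge0.
transitivity (\sum_(r \in range g)
    \int[mu]_x (((r * \1_(g @^-1` [set r]) x)%:E) * (p x)%:E))%E.
  apply: eq_fsbigr => r; rewrite inE => -[x _ gxr].
  rewrite integralZl_indic_nnsfun// integral_indic// setIT.
  transitivity (r%:E * \int[mu]_(y in g @^-1` [set r]) (p y)%:E)%E; first by [].
  rewrite integral_mkcond.
  under [in RHS]eq_integral do rewrite EFinM -muleA.
  rewrite ge0_integralZl//.
  - congr (_ * _)%E; apply: eq_integral => y _.
    rewrite patchE indicE; case: ifPn => _; first by rewrite mul1e.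
    by rewrite mul0e.
  - by apply: emeasurable_funM; apply/measurable_EFinP.
  - by move=> y _; rewrite mule_ge0// lee_fin.
  - by rewrite lee_fin -gxr.
rewrite -ge0_integral_fsum//.
- apply: eq_integral => x _; rewrite fimfunE -fsumEFin//.
  rewrite ge0_mule_fsuml// => r.
  by rewrite nnfun_muleindic_ge0.
- move=> r; apply: emeasurable_funM; apply/measurable_EFinP => //.
  exact: measurable_funM.
- move=> r x _; apply: mule_ge0; last by rewrite lee_fin.
  by rewrite EFinM nnfun_muleindic_ge0.
Qed.

(** Simple functions are handled by linearity; monotone convergence on both sides extends the
    formula to nonnegative measurable functions. *)
Lemma ge0_integral_density_measure (f : T -> \bar R) :
  measurable_fun setT f -> (forall x, 0 <= f x)%E ->
  (\int[nu]_x f x = \int[mu]_x (f x * (p x)%:E))%E.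
Proof.
move=> mf f0; pose g := nnsfun_approx measurableT mf.
have mg n : measurable_fun setT (EFin \o g n) by exact/measurable_EFinP.
have ndg x : {homo (fun n => (g n x)%:E) : m n / (m <= n)%N >-> (m <= n)%E}.
  by move=> m n mn; rewrite lee_fin; exact/lefP/nd_nnsfun_approx.
have gf x : (g n x)%:E @[n --> \oo] --> f x by exact: cvg_nnsfun_approx.
transitivity (limn (fun n => \int[nu]_x (g n x)%:E))%E.
  rewrite -monotone_convergence//.
  - by apply: eq_integral => x _; apply/esym/cvg_lim => //; exact: gf.
  - by move=> n x _; rewrite lee_fin.
under eq_fun do rewrite integral_density_measure_nnsfun.
rewrite -monotone_convergence//.
- apply: eq_integral => x _; apply/cvg_lim => //.
  by apply: cvgeZr => //; exact: gf.
- by move=> n; apply: emeasurable_funM => //; exact/measurable_EFinP.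
- by move=> n x _; rewrite mule_ge0 ?lee_fin.
- by move=> x _ m n mn; rewrite lee_wpmul2r ?lee_fin//; exact: ndg.
Qed.

End density_measure.

(** The law [P] agrees on measurable sets with the sum of a scaled atom at [x0] and a scaled measure
    of density [p]; the bounds on [tau] make both scalings nonnegative. *)
Lemma ge0_integral_sparse_signalling d (X : measurableType d) (R : realType)
    (mu : {sigma_finite_measure set X -> \bar R}) (x0 : X) (p : X -> R)
    (tau : R) (P : probability X R) (f : X -> \bar R) :
  is_density mu p -> 0 <= tau <= 1 ->
  (forall A, measurable A -> P A = sparse_signalling mu x0 p tau A) ->
  measurable_fun setT f -> (forall x, 0 <= f x)%E ->
  (\int[P]_x f x =
   (1 - tau)%:E * f x0 + tau%:E * \int[mu]_x (f x * (p x)%:E))%E.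
Proof.
move=> [mp p0 _] /andP[tau0 tau1] PE mf f0.
have tau1' : 0 <= 1 - tau by rewrite subr_ge0.
pose m1 := mscale (NngNum tau1') \d_x0.
pose m2 := mscale (NngNum tau0) (density_measure mu mp p0).
rewrite (eq_measure_integral (measure_add m1 m2)); last first.
  by move=> A mA _; apply: (etrans (PE A mA)); rewrite [RHS]measure_addE.
rewrite ge0_integral_measure_add// !ge0_integral_mscale//=.
by rewrite integral_dirac// diracT mul1e ge0_integral_density_measure.
Qed.

(** * Detection *)

Lemma measurable_fun_divr d (T : measurableType d) (R : realType) (D : set T)
    (f g : T -> R) :
  measurable_fun D f -> measurable_fun D g -> (forall x, 0 <= g x) ->
  measurable_fun D (fun x => f x / g x).
Proof.
move=> mf mg g0; apply: measurable_funM => //.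
(* For nonnegative [g] the inverse is the power of exponent -1, including at 0 where both are 0. *)
under eq_fun do rewrite -powR_inv1//.
exact: (measurableT_comp (measurable_powR _)).
Qed.

Lemma expe1n (R : realType) (n : nat) : (1 ^+ n = 1 :> \bar R)%E.
Proof. by rewrite -EFin_expe expr1n. Qed.

(** By Tonelli the extended-valued marginal integrates to 1, hence is finite almost everywhere, and
    there it agrees with the real-valued integral. Both kinds of output density are instances. *)
Lemma is_density_marginal dX dY (X : measurableType dX) (Y : measurableType dY)
    (R : realType) (m1 : {sigma_finite_measure set X -> \bar R})
    (m2 : {sigma_finite_measure set Y -> \bar R}) (h : X -> Y -> R) :
  measurable_fun setT (fun z : X * Y => h z.1 z.2) ->
  (forall x y, 0 <= h x y) ->
  (\int[m1]_x \int[m2]_y (h x y)%:E = 1)%E ->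
  is_density m2 (fun y => \int[m1]_x h x y) /\
  {ae m2, forall y, (\int[m1]_x h x y)%:E = \int[m1]_x (h x y)%:E}%E.
Proof.
move=> mh h0 h1.
pose H (z : X * Y) := (h z.1 z.2)%:E.
have mH : measurable_fun setT H by exact/measurable_EFinP.
have H0 z : (0 <= H z)%E by rewrite lee_fin.
pose G y := (\int[m1]_x (h x y)%:E)%E.
have mG : measurable_fun setT G := measurable_fun_fubini_tonelli_G H mH H0.
have G0 y : (0 <= G y)%E by apply: integral_ge0 => x _; rewrite lee_fin.
have G1 : (\int[m2]_y G y = 1)%E by rewrite -(fubini_tonelli H).
have Gae : {ae m2, forall y, (fine (G y))%:E = G y}.
  have : m2.-integrable setT G.
    apply/integrableP; split => //.
    under eq_integral do rewrite gee0_abs//.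
    by rewrite G1 ltry.
  move/(integrable_ae measurableT).
  by apply: filterS => y /(_ Logic.I) /fineK.
have mf : measurable_fun setT (fun y => fine (G y)).
  exact: (measurableT_comp (fine_measurable measurableT) mG).
split => //; split => //.
- by move=> y; exact: Rintegral_ge0.
- rewrite -G1; apply: ge0_ae_eq_integral => //.
  + exact/measurable_EFinP.
  + by move=> y _; rewrite lee_fin; exact: Rintegral_ge0.
  + by apply: filterS Gae => y.
Qed.

Lemma product_density_ge0 (T : Type) (R : realType) (n : nat) (p : T -> R)
    (t : n.-tuple T) : (forall x, 0 <= p x) -> 0 <= product_density p t.
Proof. by move=> p0; exact: prodr_ge0. Qed.

Lemma measurable_product_density d (T : measurableType d) (R : realType)
    (n : nat) (p : T -> R) :
  measurable_fun setT p ->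
  measurable_fun setT (fun t : n.-tuple T => (product_density p t)%:E).
Proof.
move=> mp; under eq_fun do rewrite -prodEFin.
apply: emeasurable_prod => i; apply/measurable_EFinP.
by apply: measurableT_comp => //; exact: measurable_tnth.
Qed.

Lemma integral_product_density d (T : measurableType d) (R : realType)
    (mu : {sigma_finite_measure set T -> \bar R}) (n : nat) (p : T -> R) :
  measurable_fun setT p -> (forall x, 0 <= p x) ->
  (\int[tuple_measure mu n]_t (product_density p t)%:E =
   (\int[mu]_x (p x)%:E) ^+ n)%E.
Proof.
move=> mp p0; under eq_integral do rewrite -prodEFin.
rewrite (@integral_tuple_measure_expn _ _ _ mu n (EFin \o p))//.
exact/measurable_EFinP.
Qed.

(* With L = p1^n / p0^n, Cauchy-Schwarz bounds the total variation distance
   by half of sqrt (E0 (L - 1)^2) = sqrt (E0 L^2 - 1); it is used here through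
   the equivalent pointwise inequality 2 a b <= a^2 + b^2. *)
Lemma detection_prob_le_second_moment d (W : measurableType d) (R : realType)
    (mu : {sigma_finite_measure set W -> \bar R}) (p0 p1 : W -> R)
    (n : nat) (eps c : R) :
  is_density mu p0 -> is_density mu p1 -> dominated_density p1 p0 ->
  (\int[mu]_w ((p1 w) ^+ 2 / p0 w)%:E <= c%:E)%E ->
  c ^+ n <= 1 + 4 * eps ^+ 2 -> 0 < eps ->
  detection_prob_le mu p0 p1 n eps.
Proof.
move=> [mp0 p00 ip0] [mp1 p10 ip1] dom S_le cn eps0.
apply: le_ereal_inf_tmp => _ [D /= mD <-].
set nu := tuple_measure mu n.
have e0 := ltW eps0.
pose P0 := @product_density W R n p0; pose P1 := @product_density W R n p1.
pose r w := (p1 w) ^+ 2 / p0 w.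
pose Q := @product_density W R n r.
have r0 w : 0 <= r w by rewrite /r divr_ge0// exprn_ge0.
have mr : measurable_fun setT r.
  by apply: measurable_fun_divr => //; exact: measurable_funX.
have P00 t : 0 <= P0 t by exact: product_density_ge0.
have P10 t : 0 <= P1 t by exact: product_density_ge0.
have Q0 t : 0 <= Q t by exact: product_density_ge0.
have mP0 := @measurable_product_density _ W R n p0 mp0.
have mP1 := @measurable_product_density _ W R n p1 mp1.
have mQ := @measurable_product_density _ W R n r mr.
have iP0 : (\int[nu]_t (P0 t)%:E = 1)%E.
  by rewrite integral_product_density// ip0 expe1n.
have iP1 : (\int[nu]_t (P1 t)%:E = 1)%E.
  by rewrite integral_product_density// ip1 expe1n.
(* By [PQ] below, [Q] is [P1 ^ 2 / P0], so this bounds the second moment E0 L^2. *)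
have iQ : (\int[nu]_t (Q t)%:E <= (1 + 4 * eps ^+ 2)%:E)%E.
  rewrite integral_product_density//.
  have S0 : (0 <= \int[mu]_w (r w)%:E)%E.
    by apply: integral_ge0 => w _; rewrite lee_fin.
  have Sfin : (\int[mu]_w (r w)%:E)%E \is a fin_num.
    by rewrite ge0_fin_numE// (le_lt_trans S_le)// ltry.
  move: S_le S0; rewrite -(fineK Sfin) !lee_fin => S_le S0.
  rewrite -EFin_expe lee_fin (le_trans _ cn)//.
  by apply: lerXn2r => //; rewrite nnegrE// (le_trans S0).
have PQ t : Q t = P1 t ^+ 2 / P0 t.
  by rewrite /Q /P1 /P0 /product_density -prodrXl -prodf_div.
have P01 t : P0 t = 0 -> P1 t = 0.
  move=> /eqP/prodf_eq0[i _ /eqP p0i]; apply/eqP/prodf_eq0.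
  by exists i => //; apply/eqP/dom.
pose F t := ((P0 t)%:E * (\1_D t)%:E + (P1 t)%:E * (\1_(~` D) t)%:E)%E.
have mD1 : measurable_fun setT (fun t => (P0 t)%:E * (\1_D t)%:E)%E.
  by apply: emeasurable_funM => //; exact/measurable_EFinP.
have mD2 : measurable_fun setT (fun t => (P1 t)%:E * (\1_(~` D) t)%:E)%E.
  apply: emeasurable_funM => //; apply/measurable_EFinP.
  by apply: measurable_indic; exact: measurableC.
have mF : measurable_fun setT F by exact: emeasurable_funD.
have F0 t : (0 <= F t)%E by rewrite adde_ge0// mule_ge0// lee_fin.
have -> : (false_alarm mu p0 D + missed_detection mu p1 D = \int[nu]_t F t)%E.
  rewrite ge0_integralD//; last 2 first.
  - by move=> t _; rewrite mule_ge0// lee_fin.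
  - by move=> t _; rewrite mule_ge0// lee_fin.
  rewrite /false_alarm /missed_detection.
  congr (_ + _)%E; rewrite [LHS]integral_mkcond; apply: eq_integral => t _; rewrite patchE indicE.
    by case: ifPn; rewrite ?mule1 ?mule0.
  by case: ifPn; rewrite ?mule1 ?mule0.
(* Write a, b for [P0 t], [P1 t]. The inequality expands (b - a - 2 eps s a)^2 / a >= 0, where s = 1
   on [D] and s = -1 off it. After integration it reads 8 eps + 2 <= 8 eps (alpha + beta) + E0 L^2 +
   1 + 4 eps^2, and E0 L^2 <= 1 + 4 eps^2 then gives alpha + beta >= 1 - eps. *)
have key t : ((4 * eps * P0 t + (4 * eps + 2) * P1 t)%:E <=
   (8 * eps)%:E * F t + (Q t + (1 + 4 * eps ^+ 2) * P0 t)%:E)%E.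
  rewrite /F -!(EFinM, EFinD) lee_fin PQ.
  have [P0t|P0t] := eqVneq (P0 t) 0.
    by rewrite P0t (P01 _ P0t) expr0n /= !(mulr0,mul0r,addr0).
  have P0gt : 0 < P0 t by rewrite lt_neqAle eq_sym P0t P00.
  rewrite !indicE in_setC.
  have [c2 [c2E ->]] : exists s : R, s ^+ 2 = 1 /\
      P0 t * (t \in D)%:R + P1 t * (~~ (t \in D))%:R =
      (P0 t + P1 t) / 2 - s * (P1 t - P0 t) / 2.
    case: (t \in D); [exists 1|exists (-1)]; split; rewrite /= ?sqrrN ?expr1n//; lra.
  set a := P0 t in P0gt *; set b := P1 t.
  rewrite -subr_ge0.
  have -> : 8 * eps * ((a + b) / 2 - c2 * (b - a) / 2) +
      (b ^+ 2 / a + (1 + 4 * eps ^+ 2) * a) - (4 * eps * a + (4 * eps + 2) * b) =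
     ((b - a - 2 * eps * c2 * a) ^+ 2 + (1 - c2 ^+ 2) * (4 * eps ^+ 2 * a ^+ 2)) / a.
    by field; rewrite gt_eqF.
  rewrite c2E subrr mul0r addr0; apply: divr_ge0; last exact: ltW.
  exact: sqr_ge0.
clearbody F.
have : (\int[nu]_t (4 * eps * P0 t + (4 * eps + 2) * P1 t)%:E <=
   \int[nu]_t ((8 * eps)%:E * F t + (Q t + (1 + 4 * eps ^+ 2) * P0 t)%:E))%E.
  apply: ge0_le_integral => //.
  - by move=> t _; rewrite lee_fin; apply: addr_ge0; apply: mulr_ge0 => //; lra.
  - under eq_fun do rewrite EFinD !EFinM.
    by apply: emeasurable_funD; apply: measurable_funeM.
  - apply: emeasurable_funD; first exact: measurable_funeM.
    under eq_fun do rewrite EFinD EFinM.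
    by apply: emeasurable_funD => //; apply: measurable_funeM.
have lin (k : R) f : 0 <= k -> measurable_fun setT f -> (forall t, 0 <= f t)%E ->
    (\int[nu]_t (k%:E * f t) = k%:E * \int[nu]_t f t)%E.
  by move=> k0 mf f0; rewrite ge0_integralZl//.
have lhsE : (\int[nu]_t (4 * eps * P0 t + (4 * eps + 2) * P1 t)%:E =
    (4 * eps + (4 * eps + 2))%:E)%E.
  under eq_integral do rewrite EFinD (EFinM (4 * eps)) (EFinM (4 * eps + 2)).
  rewrite ge0_integralD//.
  - by rewrite !lin ?iP0 ?iP1 ?mule1//; lra.
  - by move=> t _; rewrite -EFinM lee_fin !mulr_ge0.
  - exact: measurable_funeM.
  - by move=> t _; rewrite -EFinM lee_fin !mulr_ge0//; lra.
  - exact: measurable_funeM.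
have q40 : 0 <= 1 + 4 * eps ^+ 2 by rewrite addr_ge0// mulr_ge0// sqr_ge0.
have rhsE : (\int[nu]_t ((8 * eps)%:E * F t + (Q t + (1 + 4 * eps ^+ 2) * P0 t)%:E) =
    (8 * eps)%:E * \int[nu]_t F t + (\int[nu]_t (Q t)%:E + (1 + 4 * eps ^+ 2)%:E))%E.
  under eq_integral do rewrite EFinD (EFinM (1 + 4 * eps ^+ 2)).
  rewrite ge0_integralD//; last 4 first.
  - by move=> t _; rewrite mule_ge0// lee_fin; lra.
  - exact: measurable_funeM.
  - by move=> t _; rewrite -EFinM -EFinD lee_fin addr_ge0// mulr_ge0.
  - by apply: emeasurable_funD => //; apply: measurable_funeM.
  rewrite lin//; last lra.
  rewrite ge0_integralD//; last 3 first.
  - by move=> t _; rewrite lee_fin.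
  - by move=> t _; rewrite -EFinM lee_fin mulr_ge0.
  - exact: measurable_funeM.
  by rewrite lin// iP0 mule1.
rewrite lhsE rhsE => H.
have [Finf|Ffin] := eqVneq (\int[nu]_t F t)%E +oo%E; first by rewrite Finf leey.
have F0' : (0 <= \int[nu]_t F t)%E by exact: integral_ge0.
have Qf : (\int[nu]_t (Q t)%:E)%E \is a fin_num.
  rewrite ge0_fin_numE ?(le_lt_trans iQ) ?ltry//.
  by apply: integral_ge0 => t _; rewrite lee_fin.
have Ff : (\int[nu]_t F t)%E \is a fin_num by rewrite ge0_fin_numE// lt_neqAle Ffin leey.
move: H iQ; rewrite -(fineK Ff) -(fineK Qf) -!EFinM -!EFinD !lee_fin.
set f := fine _; set q := fine _ => H iQ.
rewrite -(ler_pM2l (_ : 0 < 8 * eps)); last by lra.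
nra.
Qed.

(** On [0, x] the function w e^w rises from 0 to x e^x >= x, so it takes the value x there. This
    nonnegative solution meets the constraint w >= -1, hence [xget] returns a solution. *)
Lemma lambertW0P (R : realType) (x : R) : 0 <= x ->
  lambertW0 x * expR (lambertW0 x) = x.
Proof.
move=> x0.
have [w] : exists2 w, w \in `[0, x] & w * expR w = x.
  apply: IVT => //.
    by apply: continuous_subspaceT => y; apply: cvgM => //; exact: continuous_expR.
  have : x <= x * expR x by rewrite ler_peMr// (le_trans _ (expR_ge1Dx x))// lerDl.
  by move=> xe; rewrite mul0r ge_min x0 le_max xe orbT.
rewrite in_itv /= => /andP[w0 _] wx.
have [_ ->//] : [set w : R | -1 <= w /\ w * expR w = x] (lambertW0 x).
by apply: xgetPex; exists w; split => //; apply: le_trans w0; rewrite lerN10.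
Qed.

(** * Output densities under sparse signalling *)

Section output_densities.
Context dX dY (X : measurableType dX) (Y : measurableType dY) (R : realType).
Variables (muX : {sigma_finite_measure set X -> \bar R})
  (muY : {sigma_finite_measure set Y -> \bar R}) (q : X -> Y -> R)
  (p : X -> R).
Hypotheses (hq : is_channel muY q) (hp : is_density muX p).

Let mq : measurable_fun setT (fun z : X * Y => q z.1 z.2) := hq.1.
Let q0 x y : 0 <= q x y. Proof. by have [_ ? _] := hq.2 x. Qed.
Let q1 x : (\int[muY]_y (q x y)%:E = 1)%E. Proof. by have [] := hq.2 x. Qed.

Lemma measurable_channel_l y : measurable_fun setT (q ^~ y).
Proof. exact: (measurableT_comp mq (measurable_pair2 y)). Qed.

Lemma is_density_output : is_density muY (output_density muX p q) /\
  {ae muY, forall y, (output_density muX p q y)%:E =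
                     \int[muX]_x (p x * q x y)%:E}%E.
Proof.
have [mp p0 ip] := hp.
apply: (@is_density_marginal _ _ X Y R muX muY (fun x y => p x * q x y)).
- by apply: measurable_funM => //; exact: measurableT_comp.
- by move=> x y; exact: mulr_ge0.
- rewrite -ip; apply: eq_integral => x _.
  under eq_integral do rewrite EFinM.
  have [mqx _ _] := hq.2 x.
  rewrite ge0_integralZl ?q1 ?mule1//; first exact/measurable_EFinP.
    by move=> y _; rewrite lee_fin.
  by rewrite lee_fin.
Qed.

Lemma is_density_output_law (P : probability X R) :
  is_density muY (output_density_law P q) /\
  {ae muY, forall y, (output_density_law P q y)%:E =
                     \int[P]_x (q x y)%:E}%E.
Proof.
apply: (@is_density_marginal _ _ X Y R P muY q) => //.
under eq_integral do rewrite q1.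
by rewrite integral_cst// mul1e; exact: probability_setT.
Qed.

(** Linearity of the integral in the input law. The identity may fail where the integral defining an
    output density diverges, since the real-valued integral is then 0. *)
Lemma output_density_sparse x0 (tau : R) (P : probability X R) :
  0 <= tau <= 1 ->
  (forall A, measurable A -> P A = sparse_signalling muX x0 p tau A) ->
  {ae muY, forall y, output_density_law P q y =
             (1 - tau) * q x0 y + tau * output_density muX p q y}.
Proof.
move=> tau01 PE.
have [_] := is_density_output; apply: filterS2 (is_density_output_law P).2.
move=> y Py py; apply: EFin_inj; rewrite Py.
rewrite (ge0_integral_sparse_signalling hp tau01 PE); last 2 first.
- by apply/measurable_EFinP; exact: measurable_channel_l.
- by move=> x; rewrite lee_fin.
rewrite [RHS]EFinD !EFinM py; congr (_ + _ * _)%E.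
by apply: eq_integral => x _; rewrite -EFinM mulrC.
Qed.

(** Almost everywhere p1 = q0 + tau (pt - q0), where q0 stands for [q x0]. Expanding p1^2 / q0, the
    constant term integrates to 1, the cross term 2 tau (pt - q0) to 0, and the quadratic term to
    tau^2 times chi-squared. *)
Lemma second_moment_sparse x0 (tau : R) (P : probability X R) :
  0 < tau <= 1 ->
  (forall A, measurable A -> P A = sparse_signalling muX x0 p tau A) ->
  dominated_density (output_density_law P q) (q x0) ->
  (chi2 muY (output_density muX p q) (q x0) < +oo)%E ->
  (\int[muY]_y ((output_density_law P q y) ^+ 2 / q x0 y)%:E <=
   (1 + tau ^+ 2 * fine (chi2 muY (output_density muX p q) (q x0)))%:E)%E.
Proof.
move=> /andP[tau0 tau1] PE dom chi_fin.
have tau01 : 0 <= tau <= 1 by rewrite ltW.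
have [[mp1 p10 _] _] := is_density_output_law P.
have [[mpt pt0 ipt] _] := is_density_output.
have [mq0 _ iq0] := hq.2 x0.
set p1 := output_density_law P q in dom mp1 p10 *.
set pt := output_density muX p q in mpt pt0 ipt chi_fin *.
have chi0 : (0 <= chi2 muY pt (q x0))%E.
  by apply: integral_ge0 => y _; rewrite lee_fin divr_ge0// sqr_ge0.
have chifin : chi2 muY pt (q x0) \is a fin_num by rewrite ge0_fin_numE.
have mS : measurable_fun setT (fun y => p1 y ^+ 2 / q x0 y).
  by apply: measurable_fun_divr => //; exact: measurable_funX.
have mC : measurable_fun setT (fun y => (pt y - q x0 y) ^+ 2 / q x0 y).
  by apply: measurable_fun_divr => //; apply: measurable_funX; exact: measurable_funB.
have S0 y : 0 <= p1 y ^+ 2 / q x0 y by rewrite divr_ge0// sqr_ge0.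
have C0 y : 0 <= (pt y - q x0 y) ^+ 2 / q x0 y by rewrite divr_ge0// sqr_ge0.
have Z (k : R) (f : Y -> R) : 0 <= k -> measurable_fun setT f -> (forall y, 0 <= f y) ->
    (\int[muY]_y (k%:E * (f y)%:E) = k%:E * \int[muY]_y (f y)%:E)%E.
  move=> k0 mf f0; rewrite ge0_integralZl//; first exact/measurable_EFinP.
  by move=> y _; rewrite lee_fin.
have mE (f : Y -> R) : measurable_fun setT f -> measurable_fun setT (fun y : Y => (f y)%:E : \bar R).
  by move=> mf; exact/measurable_EFinP.
have mZ (k : R) (f : Y -> R) : measurable_fun setT f ->
    measurable_fun setT (fun y : Y => (k%:E * (f y)%:E)%E : \bar R).
  by move=> mf; apply: measurable_funeM; exact/measurable_EFinP.
have tau20 : 0 <= 2 * tau by rewrite mulr_ge0// ltW.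
(* The negative part 2 tau q0 of the cross term is moved to the left, so that only nonnegative
   functions are integrated. *)
have H : (\int[muY]_y ((p1 y ^+ 2 / q x0 y)%:E + (2 * tau)%:E * (q x0 y)%:E) <=
    \int[muY]_y (((q x0 y)%:E + (2 * tau)%:E * (pt y)%:E) +
       (tau ^+ 2)%:E * ((pt y - q x0 y) ^+ 2 / q x0 y)%:E))%E.
  apply: ae_ge0_le_integral => //.
  - by move=> y _; rewrite -EFinM -EFinD lee_fin addr_ge0// mulr_ge0.
  - by apply: emeasurable_funD; [exact: mE|exact: mZ].
  - move=> y _; rewrite -!EFinM -!EFinD lee_fin !addr_ge0// mulr_ge0//.
    exact: sqr_ge0.
  - by do 2 (apply: emeasurable_funD; last exact: mZ); exact: mE.
  - apply: filterS (output_density_sparse tau01 PE) => y p1E _.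
    rewrite -!EFinM -!EFinD lee_fin -/p1 in p1E *.
    (* At a zero of [q x0], domination makes [p1] vanish too, and the quotients are 0 by
       convention. *)
    have [q00|q00] := eqVneq (q x0 y) 0.
      rewrite q00 (dom _ q00) expr0n/= !mul0r !invr0 !mulr0 !addr0 add0r.
      by rewrite mulr_ge0.
    rewrite p1E le_eqVlt -subr_eq0 -/pt; apply/orP; left.
    by apply/eqP; field.
move: H; rewrite ge0_integralD//; last 4 first.
- by move=> y _; rewrite lee_fin.
- exact: mE.
- by move=> y _; rewrite -EFinM lee_fin mulr_ge0.
- exact: mZ.
rewrite ge0_integralD//; last 4 first.
- by move=> y _; rewrite -EFinM -EFinD lee_fin addr_ge0// mulr_ge0.
- by apply: emeasurable_funD; [exact: mE|exact: mZ].
- by move=> y _; rewrite -EFinM lee_fin mulr_ge0// sqr_ge0.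
- exact: mZ.
rewrite ge0_integralD//; last 4 first.
- by move=> y _; rewrite lee_fin.
- exact: mE.
- by move=> y _; rewrite -EFinM lee_fin mulr_ge0.
- exact: mZ.
rewrite !Z ?sqr_ge0// iq0 ipt mule1 -[X in (_ + _ * X)%E]/(chi2 muY pt (q x0)).
rewrite -(fineK chifin) -!EFinM -!EFinD.
case: (\int[muY]_y _)%E => [r| |]//; rewrite ?leNye//.
by rewrite -EFinD !lee_fin; lra.
Qed.

End output_densities.

Lemma detection_prob_le_sparse dX dW (X : measurableType dX)
    (W : measurableType dW) (R : realType)
    (muX : {sigma_finite_measure set X -> \bar R})
    (muW : {sigma_finite_measure set W -> \bar R}) (q : X -> W -> R)
    (p : X -> R) (x0 : X) (P : probability X R) (tau eps : R) (n : nat) :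
  is_channel muW q -> is_density muX p -> 0 < tau <= 1 -> 0 < eps ->
  (forall A, measurable A -> P A = sparse_signalling muX x0 p tau A) ->
  dominated_density (output_density_law P q) (q x0) ->
  (chi2 muW (output_density muX p q) (q x0) < +oo)%E ->
  n%:R * tau ^+ 2 * fine (chi2 muW (output_density muX p q) (q x0)) =
    lambertW0 (4 * eps ^+ 2) ->
  detection_prob_le muW (q x0) (output_density_law P q) n eps.
Proof.
move=> hq hp tau01 eps0 PE dom chi_fin ntau.
set c := fine _ in ntau.
have c0 : 0 <= c.
  apply: fine_ge0; apply: integral_ge0 => y _; rewrite lee_fin.
  by rewrite divr_ge0 ?sqr_ge0//; have [_ ? _] := hq.2 x0.
apply: (detection_prob_le_second_moment (c := 1 + tau ^+ 2 * c)) => //.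
- exact: hq.2.
- exact: (is_density_output_law hq P).1.
- exact: (second_moment_sparse hq hp tau01 PE dom chi_fin).
set w := lambertW0 _ in ntau.
have wE : w * expR w = 4 * eps ^+ 2 by rewrite lambertW0P// mulr_ge0// sqr_ge0.
(* This is (1 + x)^n <= e^(n x), with n x = w. *)
have : (1 + tau ^+ 2 * c) ^+ n <= expR w.
  rewrite -ntau -mulrA expRM_natl lerXn2r ?nnegrE ?expR_ge0 ?expR_ge1Dx//.
  by rewrite addr_ge0// mulr_ge0// sqr_ge0.
move=> /le_trans; apply.
(* Multiplying 1 - w <= e^-w by e^w gives e^w <= 1 + w e^w. *)
rewrite -wE; have e0 := expR_gt0 w; have := expR_ge1Dx (- w).
rewrite expRN -(ler_pM2r e0) mulVf ?gt_eqF// => h; lra.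
Qed.

(** * Random coding *)

Lemma prodr_powR (R : realType) (n : nat) (a : 'I_n -> R) (r : R) :
  (forall i, 0 <= a i) ->
  \prod_(i < n) (a i `^ r) = (\prod_(i < n) a i) `^ r.
Proof.
elim: n a => [|n IH] a a0; first by rewrite !big_ord0 powR1.
by rewrite !big_ord_recl IH// powRM// prodr_ge0.
Qed.

(** The decoded message depends on [y] only through the set of indices whose test succeeds. Each
    such set [S] occurs on a finite intersection of measurable sets, and there are finitely many
    [S]. *)
Lemma is_decoder_pick dY (Y : measurableType dY) (M n : nat)
    (b : 'I_M.+1 -> n.-tuple Y -> bool) :
  (forall k, measurable [set y | b k y]) ->
  is_decoder (fun y => odflt ord0 [pick k | b k y]).
Proof.
move=> mb m.
pose B (S : {set 'I_M.+1}) := [set y | [set k | b k y]%SET = S].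
have -> : [set y | odflt ord0 [pick k | b k y] = m] =
    \bigcup_(S in [set S : {set 'I_M.+1} | odflt ord0 [pick k in S] = m]) B S.
  apply/seteqP; split => y /=.
    move=> ym; exists [set k | b k y]%SET => //=; rewrite -[RHS]ym.
    by congr odflt; apply: eq_pick => k; rewrite inE.
  move=> [S /= <- <-]; congr odflt; apply: eq_pick => k.
  by rewrite inE.
apply: fin_bigcup_measurable => // S _.
have -> : B S = \bigcap_(k in [set: 'I_M.+1])
    (if k \in S then [set y | b k y] else ~` [set y | b k y]).
  apply/seteqP; split => y /=.
    by move=> <- k _; rewrite inE; case: ifPn => //= /negP.
  move=> yS; apply/setP => k; rewrite inE; have := yS k Logic.I.
  by case: ifPn => _ /=; [move=> ->|move/negP/negbTE].
apply: fin_bigcap_measurable => // k _.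
by case: ifPn => _ //; exact: measurableC.
Qed.

(** * Marginals of product probability measures *)

Section tuple_marginals.
Context d (T : measurableType d) (R : realType) (n : nat).
Variable mu : {sigma_finite_measure set T -> \bar R}.
Hypothesis mu1 : (mu setT = 1)%E.

Let int1 : (\int[mu]_x (cst 1 x) = 1)%E.
Proof. by rewrite integral_cst// mul1e; exact: mu1. Qed.

Lemma tuple_measure_setT : (tuple_measure mu n setT = 1)%E.
Proof.
rewrite -[LHS]mul1e -(integral_cst _ measurableT).
transitivity (\int[tuple_measure mu n]_t \prod_(i < n) (cst 1 (tnth t i)))%E.
  by apply: eq_integral => t _; rewrite big1.
rewrite (integral_tuple_measure_expn mu n (measurable_cst _))//.
by rewrite int1 expe1n.
Qed.

(** Independence of two distinct coordinates: the integrand is a product over all coordinates whose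
    other factors are 1, and these integrate to 1 as [mu] has mass one. *)
Lemma integral_tuple_measure_tnth2 (i j : 'I_n) (f g : T -> \bar R) :
  i != j -> measurable_fun setT f -> measurable_fun setT g ->
  (forall x, 0 <= f x)%E -> (forall x, 0 <= g x)%E ->
  (\int[tuple_measure mu n]_t (f (tnth t i) * g (tnth t j)) =
   \int[mu]_x f x * \int[mu]_x g x)%E.
Proof.
move=> ij mf mg f0 g0.
pose h k := if k == i then f else if k == j then g else cst 1%E.
have hi : h i = f by rewrite /h eqxx.
have hj : h j = g by rewrite /h eq_sym (negbTE ij) eqxx.
have hk k : k != i -> k != j -> h k = cst 1%E by rewrite /h => /negbTE-> /negbTE->.
transitivity (\int[tuple_measure mu n]_t \prod_(k < n) h k (tnth t k))%E.
  apply: eq_integral => t _; rewrite (bigD1 i)//= (bigD1 j)/=; last by rewrite eq_sym.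
  by rewrite hi hj big1 ?mule1// => k /andP[ki kj]; rewrite hk.
rewrite integral_tuple_measure_prod; last 2 first.
- by move=> k; rewrite /h; case: (k == i) => //; case: (k == j).
- by move=> k x; rewrite /h; case: (k == i) => //; case: (k == j).
rewrite (bigD1 i)//= (bigD1 j)/=; last by rewrite eq_sym.
rewrite hi hj big1 ?mule1// => k /andP[ki kj].
by rewrite hk// int1.
Qed.

Lemma integral_tuple_measure_tnth (i : 'I_n) (f : T -> \bar R) :
  measurable_fun setT f -> (forall x, 0 <= f x)%E ->
  (\int[tuple_measure mu n]_t f (tnth t i) = \int[mu]_x f x)%E.
Proof.
move=> mf f0.
pose h k := if k == i then f else cst 1%E.
have hi : h i = f by rewrite /h eqxx.
have hk k : k != i -> h k = cst 1%E by rewrite /h => /negbTE->.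
transitivity (\int[tuple_measure mu n]_t \prod_(k < n) h k (tnth t k))%E.
  apply: eq_integral => t _; rewrite (bigD1 i)//=.
  by rewrite hi big1 ?mule1// => k ki; rewrite hk.
rewrite integral_tuple_measure_prod; last 2 first.
- by move=> k; rewrite /h; case: (k == i).
- by move=> k x; rewrite /h; case: (k == i).
rewrite (bigD1 i)//= hi big1 ?mule1// => k ki.
by rewrite hk// int1.
Qed.

End tuple_marginals.

(** * Threshold decoding of a random code *)

Section random_coding.
Context dX dY (X : measurableType dX) (Y : measurableType dY) (R : realType).
Variables (muY : {sigma_finite_measure set Y -> \bar R}) (q : X -> Y -> R)
  (P : probability X R) (s gam : R) (n M : nat).
Hypotheses (hq : is_channel muY q) (s01 : 0 < s < 1) (gam0 : 0 < gam).

Let mq : measurable_fun setT (fun z : X * Y => q z.1 z.2) := hq.1.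
Let q0 x y : 0 <= q x y. Proof. by have [_ ? _] := hq.2 x. Qed.
Let q1 x : (\int[muY]_y (q x y)%:E = 1)%E. Proof. by have [] := hq.2 x. Qed.

Local Notation Xn := (n.-tuple X).
Local Notation Yn := (n.-tuple Y).
Local Notation Pn := (tuple_measure P n).
Local Notation muYn := (tuple_measure muY n).

Let pY := output_density_law P q.
Let pY0 y : 0 <= pY y.
Proof. by have [[_ ? _] _] := is_density_output_law hq P. Qed.
Let mpY : measurable_fun setT pY.
Proof. by have [[? _ _] _] := is_density_output_law hq P. Qed.

Let qn (x : Xn) (y : Yn) : R := \prod_(i < n) q (tnth x i) (tnth y i).
Let pn (y : Yn) : R := product_density pY y.
Let vn (y : Yn) : R := gam ^+ n * pn y.
Let psi (x : Xn) (y : Yn) : R :=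
  \prod_(i < n) (q (tnth x i) (tnth y i) `^ (1 - s) *
                 (gam * pY (tnth y i)) `^ s).
Let above : set (Xn * Yn) := [set z | vn z.2 < qn z.1 z.2].

Let qn0 x y : 0 <= qn x y. Proof. exact: prodr_ge0. Qed.
Let pn0 y : 0 <= pn y. Proof. exact: product_density_ge0. Qed.
Let psi0 x y : 0 <= psi x y.
Proof. by apply: prodr_ge0 => i _; rewrite mulr_ge0 ?powR_ge0. Qed.

Let mtX (i : 'I_n) : measurable_fun setT (fun z : Xn * Yn => tnth z.1 i).
Proof. exact: (measurableT_comp (measurable_tnth i) measurable_fst). Qed.
Let mtY (i : 'I_n) : measurable_fun setT (fun z : Xn * Yn => tnth z.2 i).
Proof. exact: (measurableT_comp (measurable_tnth i) measurable_snd). Qed.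

Let mqi (i : 'I_n) :
  measurable_fun setT (fun z : Xn * Yn => q (tnth z.1 i) (tnth z.2 i)).
Proof.
exact: (measurableT_comp mq (measurable_fun_pair (mtX i) (mtY i))).
Qed.

Let mqn : measurable_fun setT (fun z : Xn * Yn => qn z.1 z.2).
Proof.
apply/measurable_EFinP.
rewrite (_ : _ \o _ = fun z : Xn * Yn =>
  \prod_(i < n) (q (tnth z.1 i) (tnth z.2 i))%:E)%E.
  by apply: emeasurable_prod => i; exact/measurable_EFinP.
by apply/funext => z /=; rewrite prodEFin.
Qed.

Let mpn : measurable_fun setT pn.
Proof. by apply/measurable_EFinP; exact: measurable_product_density. Qed.

Let mpsi1 : measurable_fun setT
  (fun z : X * Y => q z.1 z.2 `^ (1 - s) * (gam * pY z.2) `^ s).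
Proof.
apply: measurable_funM; first exact: (measurableT_comp (measurable_powR _) mq).
have m2 : measurable_fun setT (fun z : X * Y => gam * pY z.2).
  by apply: measurable_funM => //; exact: measurableT_comp.
exact: (measurableT_comp (measurable_powR _) m2).
Qed.

Let mpsi : measurable_fun setT (fun z : Xn * Yn => psi z.1 z.2).
Proof.
apply/measurable_EFinP.
rewrite (_ : _ \o _ = fun z : Xn * Yn => \prod_(i < n)
  (q (tnth z.1 i) (tnth z.2 i) `^ (1 - s) * (gam * pY (tnth z.2 i)) `^ s)%:E)%E.
  apply: emeasurable_prod => i; apply/measurable_EFinP.
  exact: (measurableT_comp mpsi1 (measurable_fun_pair (mtX i) (mtY i))).
by apply/funext => z /=; rewrite prodEFin.
Qed.

Let mabove : measurable above.
Proof.
have : measurable_fun setT (fun z : Xn * Yn => vn z.2 < qn z.1 z.2).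
  apply: measurable_fun_ltr => //.
  by apply: measurable_funM => //; exact: (measurableT_comp mpn measurable_snd).
move=> /(_ measurableT [set true]); rewrite setTI; exact.
Qed.

(** Chernoff bound: [psi] is qn^(1-s) vn^s, while qn = qn^(1-s) qn^s and qn <= vn. *)
Let psi_ge x y : qn x y <= vn y -> qn x y <= psi x y.
Proof.
move: s01 => /andP[s0 s1] qv.
have gp0 (i : 'I_n) : 0 <= gam * pY (tnth y i) by rewrite mulr_ge0// ltW.
rewrite /psi big_split/= (prodr_powR _ (fun i => q0 _ _)) (prodr_powR _ gp0).
rewrite -/(qn x y) big_split/= prodr_const card_ord -/(pn y).
have -> : gam ^+ n * \prod_(i < n) pY (tnth y i) = vn y by [].
rewrite -{1}(powRr1 (qn0 x y)) -{1}(subrK s 1) powRD; last first.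
  by rewrite subrK oner_eq0.
apply: ler_wpM2l; first exact: powR_ge0.
apply: ge0_ler_powR => //; first exact: ltW.
  by rewrite nnegrE qn0.
by rewrite nnegrE /vn mulr_ge0// exprn_ge0// ltW.
Qed.

Let b (C : codebook X M.+1 n) (k : 'I_M.+1) (y : Yn) : bool :=
  vn y < qn (tnth C k) y.
Let dec (C : codebook X M.+1 n) (y : Yn) : 'I_M.+1 := odflt ord0 [pick k | b C k y].

Let mbC C k : measurable [set y | b C k y].
Proof.
have -> : [set y | b C k y] = xsection above (tnth C k).
  by apply/seteqP; split=> y /=; rewrite /xsection/= inE.
exact: measurable_xsection.
Qed.

(** Majorant of the error integrand for message [m], measurable jointly in code and output: [psi]
    pays for the true code word missing the threshold, the sum is the union bound over wrong code
    words above it. Summing over a filtered list rather than under a condition suits the exchange of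
    sum and integral. *)
Let g (m : 'I_M.+1) (z : (M.+1).-tuple Xn * Yn) : \bar R :=
  ((psi (tnth z.1 m) z.2)%:E +
   \sum_(k <- [seq k <- index_enum 'I_M.+1 | k != m])
     (qn (tnth z.1 m) z.2)%:E * (\1_above (tnth z.1 k, z.2))%:E)%E.

Let mtC (m : 'I_M.+1) :
  measurable_fun setT (fun z : (M.+1).-tuple Xn * Yn => (tnth z.1 m, z.2)).
Proof.
apply: measurable_fun_pair => //.
exact: (measurableT_comp (measurable_tnth m) measurable_fst).
Qed.

Let mterm m k : measurable_fun setT (fun z : (M.+1).-tuple Xn * Yn =>
  (qn (tnth z.1 m) z.2)%:E * (\1_above (tnth z.1 k, z.2))%:E)%E.
Proof.
apply: emeasurable_funM; apply/measurable_EFinP.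
  exact: (measurableT_comp mqn (mtC m)).
exact: (measurableT_comp (measurable_indic mabove) (mtC k)).
Qed.

Let mpsiC m : measurable_fun setT (fun z : (M.+1).-tuple Xn * Yn =>
  (psi (tnth z.1 m) z.2)%:E).
Proof. by apply/measurable_EFinP; exact: (measurableT_comp mpsi (mtC m)). Qed.

Let mg m : measurable_fun setT (g m).
Proof.
apply: emeasurable_funD => //.
by apply: emeasurable_sum => k; exact: mterm.
Qed.

Let g0 m z : (0 <= g m z)%E.
Proof.
rewrite adde_ge0 ?lee_fin//; apply: sume_ge0 => k _.
by rewrite mule_ge0 ?lee_fin.
Qed.

(** On an error, either the true code word fails its test and [psi_ge] applies, or it passes and the
    decoder has picked another passing index, whose term of the union bound already equals [qn]. *)
Let error_prob_le (C : codebook X M.+1 n) m :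
  (error_prob muY q C (dec C) m <= \int[muYn]_y g m (C, y))%E.
Proof.
have mdec : measurable [set y | dec C y <> m].
  rewrite (_ : [set _ | _] = ~` [set y | dec C y = m])//.
  by apply: measurableC; apply: is_decoder_pick => k; exact: mbC.
have mgC : measurable_fun setT (fun y => g m (C, y)).
  exact: (measurableT_comp (mg m) (measurable_pair1 C)).
have mqC : measurable_fun setT (fun y : Yn => (qn (tnth C m) y)%:E).
  by apply/measurable_EFinP; exact: (measurableT_comp mqn (measurable_pair1 _)).
apply: (@le_trans _ _ (\int[muYn]_(y in [set y | dec C y <> m]) g m (C, y))%E).
  apply: ge0_le_integral => //.
  - by move=> y _; rewrite lee_fin qn0.
  - exact: measurable_funS mqC.
  - exact: measurable_funS mgC.
  move=> y /= decm; rewrite /g /= big_filter.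
  have t0 k : k != m -> (0 <= (qn (tnth C m) y)%:E * (\1_above (tnth C k, y))%:E)%E.
    by move=> _; rewrite mule_ge0 ?lee_fin.
  have [bm|nbm] := boolP (b C m y); last first.
    rewrite -[leLHS]adde0; apply: leeD; last exact: sume_ge0.
    by rewrite lee_fin; apply: psi_ge; rewrite leNgt.
  have [k km bk] : exists2 k, k != m & b C k y.
    move: decm; rewrite /dec; case: pickP => [k bk /= km|/(_ m)].
      by exists k => //; exact/eqP.
    by rewrite bm.
  rewrite -[leLHS]add0e; apply: leeD; first by rewrite lee_fin.
  rewrite (bigD1 k)//= -[leLHS]adde0; apply: leeD.
    by rewrite indicE mem_set// mule1.
  by apply: sume_ge0 => j /andP[jm _]; exact: t0.
by apply: ge0_subset_integral => // y _; exact: g0.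
Qed.

Let intP1 : (P setT = 1)%E. Proof. exact: probability_setT. Qed.
Let intPn1 : (Pn setT = 1)%E. Proof. exact: tuple_measure_setT intP1. Qed.

Let A : \bar R := ((\int[muY]_y \int[P]_x
  (q x y `^ (1 - s) * (gam * pY y) `^ s)%:E) ^+ n)%E.

(** Code word [m] has law [Pn]; the integral factorizes over letters, first in the code word with
    [y] frozen, then in [y]. *)
Let int_psi m :
  (\int[muYn]_y \int[tuple_measure Pn M.+1]_C (psi (tnth C m) y)%:E = A)%E.
Proof.
pose F y := (\int[P]_x (q x y `^ (1 - s) * (gam * pY y) `^ s)%:E)%E.
have mF : measurable_fun setT F.
  apply: (measurable_fun_fubini_tonelli_G
    (fun z : X * Y => (q z.1 z.2 `^ (1 - s) * (gam * pY z.2) `^ s)%:E)).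
    exact/measurable_EFinP.
  by move=> z; rewrite lee_fin mulr_ge0 ?powR_ge0.
have F0 y : (0 <= F y)%E.
  by apply: integral_ge0 => x _; rewrite lee_fin mulr_ge0 ?powR_ge0.
rewrite /A -(integral_tuple_measure_expn muY n mF F0).
apply: eq_integral => y _.
rewrite (@integral_tuple_measure_tnth _ _ _ M.+1 Pn intPn1 m
  (fun x => (psi x y)%:E)); last 2 first.
- by apply/measurable_EFinP; exact: (measurableT_comp mpsi (measurable_pair2 y)).
- by move=> x; rewrite lee_fin.
under eq_integral do rewrite -prodEFin.
rewrite (@integral_tuple_measure_prod _ _ _ P n (fun i x =>
  (q x (tnth y i) `^ (1 - s) * (gam * pY (tnth y i)) `^ s)%:E))//.
- move=> i; apply/measurable_EFinP.
  exact: (measurableT_comp mpsi1 (measurable_pair2 _)).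
- by move=> i x; rewrite lee_fin mulr_ge0 ?powR_ge0.
Qed.

(** For fixed [y] the code words [m] and [k] are independent, so the inner integral is [G y * I y],
    where [G y] is [pn y] almost everywhere. On [above] one has pn <= gam^-n qn, a change of measure
    that bounds this product by gam^-n [G y]. *)
Let int_qn_above m k : k != m ->
  (\int[muYn]_y \int[tuple_measure Pn M.+1]_C
     ((qn (tnth C m) y)%:E * (\1_above (tnth C k, y))%:E) <= (gam ^- n)%:E)%E.
Proof.
move=> km.
have mqy y : measurable_fun setT (fun x : Xn => (qn x y)%:E).
  by apply/measurable_EFinP; exact: (measurableT_comp mqn (measurable_pair2 y)).
have may y : measurable_fun setT (fun x : Xn => (\1_above (x, y))%:E : \bar R).
  apply/measurable_EFinP.
  exact: (measurableT_comp (measurable_indic mabove) (measurable_pair2 y)).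
have mEq : measurable_fun setT (fun z : Xn * Yn => (qn z.1 z.2)%:E).
  exact/measurable_EFinP.
pose G (y : Yn) := (\int[Pn]_x (qn x y)%:E)%E.
have mG : measurable_fun setT G.
  by apply: (measurable_fun_fubini_tonelli_G _ mEq) => z; rewrite lee_fin.
pose I (y : Yn) := (\int[Pn]_x (\1_above (x, y))%:E)%E.
have mI : measurable_fun setT I.
  apply: (measurable_fun_fubini_tonelli_G (fun z => (\1_above z)%:E)).
    by apply/measurable_EFinP; exact: measurable_indic.
  by move=> z; rewrite lee_fin.
(* The letterwise identity holds off a null set of letters, hence on almost every word. *)
have GE : {ae muYn, forall y, G y = (pn y)%:E}.
  have := tuple_measure_negligible n (is_density_output_law hq P).2.
  apply: filterS => y Hy; rewrite /G.
  under eq_integral do rewrite -prodEFin.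
  rewrite (@integral_tuple_measure_prod _ _ _ P n (fun i x =>
     (q x (tnth y i))%:E)).
  - by rewrite -prodEFin; apply: eq_bigr => i _; rewrite -Hy.
  - by move=> i; apply/measurable_EFinP; exact: (measurable_channel_l hq).
  - by move=> i x; rewrite lee_fin.
have G0 y : (0 <= G y)%E by apply: integral_ge0 => x _; rewrite lee_fin.
have I0 y : (0 <= I y)%E by apply: integral_ge0 => x _; rewrite lee_fin.
have gn0 : 0 < gam ^+ n by exact: exprn_gt0.
have gnV0 : 0 <= gam ^- n by rewrite invr_ge0 ltW.
(* Since [G] integrates to 1, the constant becomes an integral and the claim reduces to a pointwise
   comparison in [y]. *)
have -> : ((gam ^- n)%:E = \int[muYn]_y ((gam ^- n)%:E * G y))%E.
  rewrite ge0_integralZl//.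
  rewrite -(@fubini_tonelli _ _ _ _ _ Pn muYn (fun z => (qn z.1 z.2)%:E))//=.
    under eq_integral do under eq_integral do rewrite -prodEFin.
    under eq_integral => x _.
      rewrite (@integral_tuple_measure_prod _ _ _ muY n (fun i y =>
        (q (tnth x i) y)%:E)); last 2 first.
      + by move=> i; apply/measurable_EFinP; have [] := hq.2 (tnth x i).
      + by move=> i y; rewrite lee_fin.
      rewrite big1; last by move=> i _; exact: q1.
      over.
    rewrite integral_cst// mul1e -[LHS]mule1; congr (_ * _)%E.
    exact: (esym intPn1).
  by move=> z; rewrite lee_fin.
under eq_integral => y _.
  rewrite (@integral_tuple_measure_tnth2 _ _ _ M.+1 Pn intPn1 m k
    (fun x => (qn x y)%:E) (fun x => (\1_above (x, y))%:E))//; last 2 first.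
  - by rewrite eq_sym.
  - by move=> x; rewrite lee_fin.
  over.
apply: ae_ge0_le_integral => //.
- by move=> y _; exact: (mule_ge0 (G0 y) (I0 y)).
- exact: (emeasurable_funM mG mI).
- by move=> y _; rewrite mule_ge0.
- exact: measurable_funeM.
apply: filterS GE => y GyE _; rewrite -/(G y) -/(I y).
have pny0 : (0 <= (pn y)%:E)%E by rewrite lee_fin.
have qx0 x : setT x -> (0 <= (qn x y)%:E)%E by rewrite lee_fin.
have ax0 x : setT x -> (0 <= (\1_above (x, y))%:E :> \bar R)%E by rewrite lee_fin.
have -> : (G y * I y = \int[Pn]_x ((pn y)%:E * (\1_above (x, y))%:E))%E.
  by rewrite GyE ge0_integralZl.
have -> : ((gam ^- n)%:E * G y = \int[Pn]_x ((gam ^- n)%:E * (qn x y)%:E))%E.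
  by rewrite ge0_integralZl// lee_fin.
apply: ge0_le_integral => //.
- by move=> x _; rewrite mule_ge0// lee_fin.
- exact: measurable_funeM.
- exact: measurable_funeM.
move=> x _; rewrite -!EFinM lee_fin indicE.
have [/set_mem/= ab|] := boolP (_ \in _); last first.
  by move=> _; rewrite mulr0 mulr_ge0.
by rewrite mulr1 ler_pdivlMl// ltW.
Qed.

Let int_g m : (\int[tuple_measure Pn M.+1]_C \int[muYn]_y g m (C, y) <=
  A + (M.+1%:R * gam ^- n)%:E)%E.
Proof.
rewrite (fubini_tonelli (g m))//=.
under eq_integral => y _.
  rewrite ge0_integralD//; last 4 first.
  - by move=> C _; rewrite lee_fin.
  - exact: (measurableT_comp (mpsiC m) (measurable_pair2 y)).
  - by move=> C _; apply: sume_ge0 => k _; rewrite mule_ge0 ?lee_fin.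
  - apply: emeasurable_sum => k.
    exact: (measurableT_comp (mterm m k) (measurable_pair2 y)).
  rewrite ge0_integral_sum//; last 2 first.
  - by move=> k; exact: (measurableT_comp (mterm m k) (measurable_pair2 y)).
  - by move=> k C _; rewrite mule_ge0 ?lee_fin.
  over.
rewrite ge0_integralD//; last 4 first.
- by move=> y _; apply: integral_ge0 => C _; rewrite lee_fin.
- apply: (measurable_fun_fubini_tonelli_G _ (mpsiC m)) => z.
  by rewrite lee_fin.
- move=> y _; apply: sume_ge0 => k _; apply: integral_ge0 => C _.
  by rewrite mule_ge0 ?lee_fin.
- apply: emeasurable_sum => k.
  apply: (measurable_fun_fubini_tonelli_G _ (mterm m k)) => z.
  by rewrite mule_ge0 ?lee_fin.
rewrite int_psi; apply: leeD => //.
rewrite ge0_integral_sum//; last 2 first.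
- move=> k; apply: (measurable_fun_fubini_tonelli_G _ (mterm m k)) => z.
  by rewrite mule_ge0 ?lee_fin.
- by move=> k y _; apply: integral_ge0 => C _; rewrite mule_ge0 ?lee_fin.
rewrite big_filter.
(* The [M] wrong messages are then counted as [M.+1]. *)
apply: (@le_trans _ _ (\sum_(k < M.+1 | k != m) (gam ^- n)%:E)%E).
  by apply: lee_sum => k km; exact: int_qn_above.
have gnV0 : 0 <= gam ^- n by rewrite invr_ge0 exprn_ge0// ltW.
rewrite sumEFin lee_fin mulr_natl -[in leRHS](card_ord M.+1) -sumr_const.
by rewrite big_mkcond/=; apply: ler_sum => k _; case: ifP.
Qed.

(* Shannon's threshold decoding: the received word is decoded as the first
   message m such that prod_i q(x_m,i, y_i) exceeds prod_i (gam pY(y_i)). The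
   true message fails this test with expected probability at most the s-th
   Chernoff bound, and each wrong one passes it with expected probability at
   most gam^-n. *)
Lemma exist_in_ensemble_threshold (eps : R) :
  ((\int[muY]_y \int[P]_x (q x y `^ (1 - s) *
      (gam * output_density_law P q y) `^ s)%:E) ^+ n +
    (M.+1%:R * gam ^- n)%:E < eps%:E)%E ->
  exist_in_ensemble P
    (fun C : codebook X M.+1 n => decodable muY q eps C).
Proof.
move=> small neg.
have M0 : (0 <= (M.+1%:R^-1)%:E :> \bar R)%E by rewrite lee_fin.
pose G C := ((M.+1%:R^-1)%:E * \sum_(m < M.+1) \int[muYn]_y g m (C, y))%E.
have mG1 m : measurable_fun setT (fun C => \int[muYn]_y g m (C, y))%E.
  exact: (measurable_fun_fubini_tonelli_F _ (mg m)).
have G10 m C : (0 <= \int[muYn]_y g m (C, y))%E by exact: integral_ge0.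
have mG : measurable_fun setT G.
  by apply: measurable_funeM; apply: emeasurable_sum.
have G0 C : (0 <= G C)%E by rewrite mule_ge0// sume_ge0.
have intG : (\int[tuple_measure Pn M.+1]_C G C < eps%:E)%E.
  apply: (le_lt_trans _ small); rewrite ge0_integralZl//; last 2 first.
  - exact: emeasurable_sum.
  - by move=> C _; exact: sume_ge0.
  rewrite ge0_integral_sum//.
  apply: (@le_trans _ _ ((M.+1%:R^-1)%:E *
      \sum_(m < M.+1) (A + (M.+1%:R * gam ^- n)%:E))%E).
    by apply: lee_wpmul2l => //; apply: lee_sum => m _; exact: int_g.
  have A0 : (0 <= A)%E.
    apply: expe_ge0; apply: integral_ge0 => y _; apply: integral_ge0 => x _.
    by rewrite lee_fin mulr_ge0 ?powR_ge0.
  rewrite -/A; set c := (A + _)%E.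
  have c0 : (0 <= c)%E.
    by rewrite adde_ge0// lee_fin mulr_ge0// invr_ge0 exprn_ge0// ltW.
  have : c \is a fin_num.
    by rewrite ge0_fin_numE//; apply: (lt_trans small); rewrite ltry.
  move=> /fineK <-; rewrite sumEFin sumr_const card_ord -EFinM lee_fin.
  by rewrite -[X in _ * X]mulr_natl mulrA mulVf ?mul1r// pnatr_eq0.
have good C : (G C <= eps%:E)%E -> decodable muY q eps C.
  move=> GC; exists (dec C); first by apply: is_decoder_pick => k; exact: mbC.
  apply: le_trans GC; apply: lee_wpmul2l => //.
  by apply: lee_sum => m _; exact: error_prob_le.
(* If the decodable codes were negligible, [G] would be at least [eps] almost everywhere, and so
   would its mean, against [intG]. *)
have : (eps%:E <= \int[tuple_measure Pn M.+1]_C G C)%E.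
  have -> : (eps%:E = \int[tuple_measure Pn M.+1]_C (cst eps%:E C))%E.
    rewrite integral_cst// -[LHS]mule1; congr (_ * _)%E.
    exact: (esym (tuple_measure_setT _ intPn1)).
  have eps0 : (0 <= eps%:E)%E.
    by apply: le_trans (ltW intG); exact: integral_ge0.
  apply: ae_ge0_le_integral => //.
  apply: negligibleS neg => C /= nG; apply: good.
  apply/ltW; rewrite ltNge; apply/negP => GC.
  by apply: nG => _.
by rewrite leNgt intG.
Qed.

End random_coding.

(** * The error exponent *)

(** With x = e^z, apply 1 + u <= e^u at u = (1 - r) z and at u = - r z, and combine the results with
    weights r and 1 - r: the terms linear in z cancel. *)
Lemma powR_le_affine (R : realType) (x r : R) : 0 <= x -> 0 <= r <= 1 ->
  x `^ r <= 1 - r + r * x.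
Proof.
move=> x0 /andP[r0 r1].
have [->|xn0] := eqVneq x 0.
  have [->|rn0] := eqVneq r 0; first by rewrite powRr0 mul0r; lra.
  by rewrite powR0//; lra.
have xgt0 : 0 < x by rewrite lt_neqAle eq_sym xn0.
pose z := ln x; have xE : x = expR z by rewrite lnK.
rewrite xE -expRM.
have e0 := expR_gt0 (z * r).
have h1 : expR (z * r) * (1 + (1 - r) * z) <= expR z.
  have -> : expR z = expR (z * r) * expR ((1 - r) * z).
    by rewrite -expRD; congr expR; ring.
  by rewrite ler_pM2l// expR_ge1Dx.
have h2 : expR (z * r) * (1 - r * z) <= 1.
  rewrite [leRHS](_ : 1 = expR (z * r) * expR (- (r * z))); last first.
    by rewrite -expRD (_ : _ + _ = 0) ?expR0//; ring.
  by rewrite ler_pM2l// expR_ge1Dx.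
have h3 := ler_wpM2l r0 h1.
have r1' : 0 <= 1 - r by lra.
have h4 := ler_wpM2l r1' h2.
have := lerD h3 h4.
by rewrite [leLHS](_ : _ = expR (z * r)); [move=> h; lra|ring].
Qed.

(** This is [powR_le_affine] at v / u, multiplied by u. *)
Lemma powR_young (R : realType) (u v s : R) : 0 <= u -> 0 <= v -> 0 < s < 1 ->
  u `^ (1 - s) * v `^ s <= (1 - s) * u + s * v.
Proof.
move=> u0 v0 /andP[s0 s1].
have [->|un0] := eqVneq u 0.
  rewrite powR0; last by rewrite subr_eq0 gt_eqF.
  by rewrite mul0r mulr0 add0r mulr_ge0// ltW.
have ugt0 : 0 < u by rewrite lt_neqAle eq_sym un0.
have -> : u `^ (1 - s) * v `^ s = u * (v / u) `^ s.
  rewrite powRM ?invr_ge0// -powR_inv1// -powRrM mulN1r mulrCA [RHS]mulrC.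
  rewrite -{2}(powRr1 u0) -powRD ?un0 ?implybT//.
have h : (v / u) `^ s <= 1 - s + s * (v / u).
  by apply: powR_le_affine; [exact: divr_ge0|rewrite !ltW].
apply: (le_trans (ler_wpM2l u0 h)); rewrite le_eqVlt; apply/orP; left.
by apply/eqP; field.
Qed.

(* Two applications of AM-GM: the likelihood ratio w / u is split as
   (t / u) (w / t), and the second factor is linearized. *)
Lemma powR_split_le (R : realType) (u t w s : R) :
  0 <= u -> 0 < t -> 0 <= w -> 0 < s <= 1 / 2 ->
  u `^ (1 - s) * w `^ s <=
  1 / 2 * (u * (t / u) `^ (2 * s)) +
  1 / 2 * ((1 - 2 * s) * u + 2 * s * (u * (w / t))).
Proof.
move=> u0 t0 w0 /andP[s0 s12].
have [->|un0] := eqVneq u 0.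
  rewrite powR0; last by rewrite subr_eq0 gt_eqF//; lra.
  by rewrite !(mul0r, mulr0, addr0).
have ugt0 : 0 < u by rewrite lt_neqAle eq_sym un0.
pose a := t / u; pose b := w / t.
have a0 : 0 <= a by rewrite divr_ge0// ltW.
have b0 : 0 <= b by rewrite divr_ge0// ltW.
have -> : u `^ (1 - s) * w `^ s = u * (a `^ s * b `^ s).
  rewrite -powRM// (_ : a * b = w / u); last first.
    by rewrite /a /b; field; rewrite !gt_eqF.
  rewrite powRM ?invr_ge0// -powR_inv1// -powRrM mulN1r mulrCA [RHS]mulrC.
  by rewrite -{2}(powRr1 u0) -powRD ?un0 ?implybT.
have sq x : 0 <= x -> x `^ (2 * s) = (x `^ s) ^+ 2.
  by move=> x0; rewrite mulrC powRrM powR_mulrn// powR_ge0.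
have h : b `^ (2 * s) <= 1 - 2 * s + 2 * s * b.
  by apply: powR_le_affine => //; apply/andP; split; lra.
rewrite -/a -/b [leRHS](_ : _ =
  u * ((1 / 2) * (a `^ (2 * s) + (1 - 2 * s + 2 * s * b)))); last by ring.
apply: ler_wpM2l => //.
apply: (@le_trans _ _ (1 / 2 * (a `^ (2 * s) + b `^ (2 * s)))).
  rewrite !sq// -subr_ge0.
  rewrite [leRHS](_ : _ = 1 / 2 * (a `^ s - b `^ s) ^+ 2); last by field.
  by rewrite mulr_ge0// sqr_ge0.
by rewrite ler_pM2l// lerD2l.
Qed.

Lemma limn_einf_ge (R : realType) (u : (\bar R)^nat) (x : \bar R) :
  (\forall n \near \oo, (x <= u n)%E) -> (x <= limn_einf u)%E.
Proof.
move=> [N _ Nu]; rewrite limn_einf_lim; apply: lime_ge; first exact: is_cvg_einfs.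
exists N => // n /= Nn; apply: le_ereal_inf_tmp => _ [m /= nm <-].
by apply: Nu => /=; exact: leq_trans nm.
Qed.

Lemma limn_einf_le (R : realType) (u : (\bar R)^nat) (x : \bar R) :
  (forall n, (u n <= x)%E) -> (limn_einf u <= x)%E.
Proof.
move=> ux; rewrite limn_einf_lim; apply: lime_le; first exact: is_cvg_einfs.
apply: nearW => n; apply: le_trans (ux n).
by apply: ereal_inf_lbound; exists n => /=.
Qed.

(* (1 - a^r) / r tends to - ln a as r -> 0+, by 1 - e^u >= - u / (1 - u). *)
Lemma oppr_ln_le_limn_einf (R : realType) (a c e : R) : 0 < a -> 0 <= c ->
  ((c * - ln a + e)%:E <=
   limn_einf (fun k => (c * (k.+1%:R * (1 - a `^ k.+1%:R^-1)) + e)%:E))%E.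
Proof.
move=> a0 c0; pose l := ln a.
pose v (k : nat) : R := c * (- l / (1 - l * k.+1%:R^-1)) + e.
have h1 : 1 - l * (k.+1%:R^-1 : R) @[k --> \oo] --> (1 : R).
  rewrite -[X in _ --> X]subr0 -(mulr0 l).
  by apply: cvgB; [exact: cvg_cst|apply: cvgMl_tmp; exact: cvg_harmonic].
have hv : v k @[k --> \oo] --> c * - l + e.
  apply: cvgD; last exact: cvg_cst.
  apply: cvgMl_tmp; rewrite -[X in _ --> X]mulr1 -[X in _ * X]invr1.
  by apply: cvgMl_tmp; apply: cvgV => //; rewrite oner_eq0.
(* The minorant [v] converges to the left-hand side but need not dominate it, so the bound is proved
   up to an arbitrary loss. *)
apply/lee_addgt0Pr => eps eps0; rewrite -leeBlDr//.
apply: limn_einf_ge.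
have near1 : \forall k \near \oo, 0 < 1 - l * (k.+1%:R^-1 : R).
  by move/cvgr_gt : h1; apply; rewrite ltr01.
have near2 : \forall k \near \oo, c * - l + e - eps < v k.
  by move/cvgr_gt : hv; apply; rewrite ltrBlDr ltrDl.
apply: filterS2 near1 near2 => k k1 k2.
rewrite -EFinB lee_fin (le_trans (ltW k2))// lerD2r ler_wpM2l//.
have k0 : 0 < k.+1%:R :> R by rewrite ltr0n.
set r := k.+1%:R^-1 in k1 *; have rE : k.+1%:R = r^-1 by rewrite invrK.
have r0 : 0 < r by rewrite invr_gt0.
have -> : a `^ r = expR (l * r) by rewrite expRM lnK.
have : (expR (l * r)) * (1 - l * r) <= 1.
  rewrite [leRHS](_ : 1 = expR (l * r) * expR (- (l * r))); last first.
    by rewrite -expRD subrr expR0.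
  by rewrite ler_pM2l ?expR_gt0// expR_ge1Dx.
rewrite -ler_pdivlMr// => h.
rewrite rE [leRHS]mulrC ler_pdivlMr// mulrAC ler_pdivrMr//.
by move: h; rewrite ler_pdivlMr//; nra.
Qed.

(** * Chernoff exponent and mutual information *)

Section exponent.
Context dX dY (X : measurableType dX) (Y : measurableType dY) (R : realType).
Variables (muX : {sigma_finite_measure set X -> \bar R})
  (muY : {sigma_finite_measure set Y -> \bar R}) (q : X -> Y -> R)
  (p : X -> R).
Hypotheses (hq : is_channel muY q) (hp : is_density muX p).

Let mq : measurable_fun setT (fun z : X * Y => q z.1 z.2) := hq.1.
Let q0 x y : 0 <= q x y. Proof. by have [_ ? _] := hq.2 x. Qed.
Let q1 x : (\int[muY]_y (q x y)%:E = 1)%E. Proof. by have [] := hq.2 x. Qed.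
Let p0 x : 0 <= p x. Proof. by have [_ ? _] := hp. Qed.
Let mp : measurable_fun setT p. Proof. by have [? _ _] := hp. Qed.

Let qt := output_density muX p q.
Let qt0 y : 0 <= qt y.
Proof. by have [[_ ? _] _] := is_density_output hq hp. Qed.
Let mqt : measurable_fun setT qt.
Proof. by have [[? _ _] _] := is_density_output hq hp. Qed.
Let iqt : (\int[muY]_y (qt y)%:E = 1)%E.
Proof. by have [[_ _ ?] _] := is_density_output hq hp. Qed.

Local Notation nu := (muX \x muY)%E.
Let J (z : X * Y) : R := p z.1 * q z.1 z.2.
(** Likelihood ratio of the product of the marginals against the joint law, so that the mutual
    information is the integral of - J ln a. *)
Let a (z : X * Y) : R := qt z.2 / q z.1 z.2.

Let J0 z : 0 <= J z. Proof. exact: mulr_ge0. Qed.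
Let a0 z : 0 <= a z. Proof. exact: divr_ge0. Qed.
Let mp1 : measurable_fun setT (fun z : X * Y => p z.1).
Proof. exact: (measurableT_comp mp measurable_fst). Qed.
Let mqt2 : measurable_fun setT (fun z : X * Y => qt z.2).
Proof. exact: (measurableT_comp mqt measurable_snd). Qed.
Let mJ : measurable_fun setT J.
Proof. exact: measurable_funM. Qed.
Let ma : measurable_fun setT a.
Proof. by apply: measurable_fun_divr. Qed.

Let integral_J (f : Y -> R) : measurable_fun setT f -> (forall y, 0 <= f y) ->
  (\int[nu]_z (J z * f z.2)%:E = \int[muY]_y (f y * qt y)%:E)%E.
Proof.
move=> mf f0.
have mf2 : measurable_fun setT (fun z : X * Y => f z.2).
  exact: (measurableT_comp mf measurable_snd).
rewrite (fubini_tonelli2 (fun z => (J z * f z.2)%:E)); last 2 first.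
- by apply/measurable_EFinP; exact: measurable_funM.
- by move=> z; rewrite lee_fin mulr_ge0.
rewrite /fubini_G /=.
have mJy y : measurable_fun setT (fun x => (J (x, y))%:E).
  by apply/measurable_EFinP; exact: (measurableT_comp mJ (measurable_pair2 y)).
have E1 y : (\int[muX]_x (J (x, y) * f y)%:E =
    (f y)%:E * \int[muX]_x (J (x, y))%:E)%E.
  under eq_integral do rewrite mulrC EFinM.
  rewrite ge0_integralZl//; last by rewrite lee_fin.
  by move=> x _; rewrite lee_fin.
under eq_integral do rewrite E1.
apply: ge0_ae_eq_integral => //.
- apply: emeasurable_funM; first exact/measurable_EFinP.
  apply: (measurable_fun_fubini_tonelli_G (fun z => (J z)%:E)).
    exact/measurable_EFinP.
  by move=> z; rewrite lee_fin.
- by apply/measurable_EFinP; exact: measurable_funM.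
- move=> y _; rewrite mule_ge0 ?lee_fin//.
  by apply: integral_ge0 => x _; rewrite lee_fin.
- by move=> y _; rewrite lee_fin mulr_ge0.
- apply: filterS (is_density_output hq hp).2 => y /= <- _.
  by rewrite EFinM.
Qed.

Let int_J : (\int[nu]_z (J z)%:E = 1)%E.
Proof.
transitivity (\int[nu]_z (J z * cst 1 z.2)%:E)%E.
  by apply: eq_integral => z _; rewrite mulr1.
rewrite integral_J// -iqt; apply: eq_integral => y _.
by rewrite mul1r.
Qed.

(** Apply [integral_J] to the indicator of the zeros of [qt]. These zeros include the points where
    the integral defining [qt] diverges, and there [J] may be positive; hence the almost
    everywhere. *)
Let J_qt0 : {ae nu, forall z, qt z.2 = 0 -> J z = 0}.
Proof.
pose f (y : Y) : R := (qt y == 0)%:R.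
have mf : measurable_fun setT f.
  have -> : f = \1_(qt @^-1` [set 0]).
    by apply/funext => y; rewrite indicE /f; congr (nat_of_bool _)%:R;
      apply/eqP/idP => [h|/set_mem]; [apply/mem_set|].
  by apply: measurable_indic; rewrite -[X in measurable X]setTI; exact: mqt.
have f0 y : 0 <= f y by rewrite /f ler0n.
have I0 : (\int[nu]_z (J z * f z.2)%:E = 0)%E.
  rewrite integral_J//; apply: integral0_eq => y _.
  by rewrite /f; case: eqP => [->|_]; rewrite ?mulr0 ?mul0r.
have mJf : measurable_fun setT (fun z => (J z * f z.2)%:E).
  apply/measurable_EFinP; apply: measurable_funM => //.
  exact: (measurableT_comp mf measurable_snd).
have := (ae_eq_integral_abs nu measurableT mJf).1.
have -> : (\int[nu]_x `|(J x * f x.2)%:E| = 0)%E.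
  rewrite -I0; apply: eq_integral => z _.
  by rewrite gee0_abs// lee_fin mulr_ge0.
move=> /(_ erefl); apply: filterS => z /(_ Logic.I) /= + qz0.
by rewrite /f qz0 eqxx mulr1 => -[].
Qed.

(** Suppose every r = 1 / (k + 1) fails. Then the functions (1 - a^r) / r, corrected to be
    nonnegative, have integrals bounded in terms of [K], and Fatou's lemma carries the bound to
    their limit - ln a, so that the mutual information is at most [K]. *)
Lemma mutual_information_limit (K : R) :
  (K%:E < mutual_information muX muY p q)%E ->
  exists2 r : R, 0 < r <= 1 &
    (\int[nu]_z (J z * a z `^ r)%:E <= (1 - r * K)%:E)%E.
Proof.
move=> KI; apply: contrapT => noR.
pose r (k : nat) : R := k.+1%:R^-1.
have r01 k : 0 < r k <= 1 by rewrite invr_gt0 ltr0n/= invf_le1// ler1n.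
have big k : ((1 - r k * K)%:E < \int[nu]_z (J z * a z `^ r k)%:E)%E.
  by rewrite ltNge; apply/negP => h; apply: noR; exists (r k).
have mJa : measurable_fun setT (fun z => J z * a z) by exact: measurable_funM.
have mar k : measurable_fun setT (fun z => a z `^ r k).
  exact: (measurableT_comp (measurable_powR _) ma).
have mJar k : measurable_fun setT (fun z => J z * a z `^ r k).
  exact: measurable_funM.
have Jar0 k z : 0 <= J z * a z `^ r k by rewrite mulr_ge0// powR_ge0.
(* Mass that the product of the marginals puts on the set where [q] is nonzero. Being at most 1 it
   is finite, so it can be cancelled at the end. *)
pose alpha := (\int[nu]_z (J z * a z)%:E)%E.
have alpha0 : (0 <= alpha)%E.
  by apply: integral_ge0 => z _; rewrite lee_fin mulr_ge0.
have alpha1 : (alpha <= 1)%E.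
  have -> : (1 = \int[nu]_z (p z.1 * qt z.2)%:E)%E.
    rewrite (fubini_tonelli1 (fun z => (p z.1 * qt z.2)%:E))/=; last 2 first.
    - by apply/measurable_EFinP; exact: measurable_funM.
    - by move=> z; rewrite lee_fin mulr_ge0.
    have [_ _ <-] := hp; apply: eq_integral => x _; rewrite /fubini_F/=.
    under eq_integral do rewrite EFinM.
    rewrite ge0_integralZl//; last 3 first.
    - exact/measurable_EFinP.
    - by move=> y _; rewrite lee_fin.
    - by rewrite lee_fin.
    by rewrite iqt mule1.
  apply: ge0_le_integral => //.
  - by move=> z _; rewrite lee_fin mulr_ge0.
  - exact/measurable_EFinP.
  - by apply/measurable_EFinP; exact: measurable_funM.
  - move=> z _; rewrite lee_fin /J /a -mulrA ler_wpM2l//.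
    have [->|qn] := eqVneq (q z.1 z.2) 0; first by rewrite mul0r.
    by rewrite mulrCA mulfV// mulr1.
have alpha_fin : alpha \is a fin_num.
  by rewrite ge0_fin_numE// (le_lt_trans alpha1)// ltry.
(* The correction [J a - J] makes [Phi] nonnegative, by a^r <= 1 - r + r a, as Fatou's lemma
   requires; its integral [alpha - 1] does not depend on [k]. *)
pose Phi (k : nat) (z : X * Y) : R :=
  J z * (k.+1%:R * (1 - a z `^ r k)) + (J z * a z - J z).
have mPhi k : measurable_fun setT (Phi k).
  apply: measurable_funD; last exact: measurable_funB.
  by apply: measurable_funM => //; apply: measurable_funM => //; exact: measurable_funB.
(* Moving the negative terms across leaves nonnegative functions only, whose integrals add up. *)
have PhiE k z : Phi k z + (k.+1%:R * (J z * a z `^ r k) + J z) =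
    k.+1%:R * J z + J z * a z.
  by rewrite /Phi; ring.
have Phi0 k z : 0 <= Phi k z.
  have := powR_le_affine (a0 z) (_ : 0 <= r k <= 1).
  have /andP[rk0 rk1] := r01 k; rewrite ltW// rk1 => /(_ isT) h.
  rewrite /Phi (_ : _ + _ = J z * (k.+1%:R * (1 - a z `^ r k) + (a z - 1))); last by ring.
  apply: mulr_ge0 => //.
  have -> : k.+1%:R = (r k)^-1 by rewrite /r invrK.
  have -> : a z - 1 = (r k)^-1 * (r k * (a z - 1)) by rewrite mulKf// gt_eqF.
  by rewrite -mulrDr mulr_ge0 ?invr_ge0 ?(ltW rk0)//; lra.
have intPhi k : (\int[nu]_z (Phi k z)%:E <= (K + fine alpha - 1)%:E)%E.
  have : (\int[nu]_z (Phi k z + (k.+1%:R * (J z * a z `^ r k) + J z))%:E =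
      k.+1%:R%:E + alpha)%E.
    under eq_integral do rewrite PhiE EFinD EFinM.
    rewrite ge0_integralD//; last 4 first.
    - by move=> z _; rewrite mule_ge0// lee_fin.
    - by apply: measurable_funeM; exact/measurable_EFinP.
    - by move=> z _; rewrite lee_fin mulr_ge0.
    - exact/measurable_EFinP.
    rewrite ge0_integralZl ?int_J ?mule1//; last 2 first.
    - exact/measurable_EFinP.
    - by move=> z _; rewrite lee_fin.
  under eq_integral do rewrite EFinD.
  rewrite ge0_integralD//; last 4 first.
  - by move=> z _; rewrite lee_fin.
  - exact/measurable_EFinP.
  - by move=> z _; rewrite lee_fin addr_ge0// mulr_ge0.
  - by apply/measurable_EFinP; apply: measurable_funD => //; exact: measurable_funM.
  have -> : (\int[nu]_z (k.+1%:R * (J z * a z `^ r k) + J z)%:E =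
     k.+1%:R%:E * \int[nu]_z (J z * a z `^ r k)%:E + 1)%E.
    under eq_integral do rewrite EFinD EFinM.
    rewrite ge0_integralD//; last 4 first.
    - by move=> z _; rewrite mule_ge0// lee_fin.
    - by apply: measurable_funeM; exact/measurable_EFinP.
    - by move=> z _; rewrite lee_fin.
    - exact/measurable_EFinP.
    rewrite int_J ge0_integralZl//.
    - exact/measurable_EFinP.
    - by move=> z _; rewrite lee_fin.
  have P0 : (0 <= \int[nu]_z (Phi k z)%:E)%E.
    by apply: integral_ge0 => z _; rewrite lee_fin.
  have I0 : (0 <= \int[nu]_z (J z * a z `^ r k)%:E)%E.
    by apply: integral_ge0 => z _; rewrite lee_fin.
  move: P0 I0 (big k); rewrite -(fineK alpha_fin).
  case: (\int[nu]_z (Phi k z)%:E)%E => [u| |]//;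
    case: (\int[nu]_z (J z * a z `^ r k)%:E)%E => [w| |]//; last 2 first.
  - by rewrite gt0_muley ?lte_fin ?ltr0n.
  - by rewrite gt0_muley ?lte_fin ?ltr0n.
  rewrite -!(EFinM, EFinD) !lee_fin lte_fin => u0 w0 h [e].
  have k0 : 0 < k.+1%:R :> R by rewrite ltr0n.
  move: h; rewrite -(ltr_pM2l k0) mulrBr mulr1 mulrA /r mulfV ?mul1r ?gt_eqF//.
  by move: e; lra.
pose L z := limn_einf (fun k => (Phi k z)%:E).
have mPhiE k : measurable_fun setT (fun z => (Phi k z)%:E) by exact/measurable_EFinP.
have PhiE0 k z : setT z -> (0 <= (Phi k z)%:E)%E by move=> _; rewrite lee_fin.
have L0 z : (0 <= L z)%E by apply: limn_einf_ge; apply: nearW => k; rewrite lee_fin.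
have mL : measurable_fun setT L.
  apply: (emeasurable_fun_cvg (fun k z => einfs (fun j => (Phi j z)%:E) k)).
    by move=> k; exact: measurable_fun_einfs.
  by move=> z _; rewrite /L limn_einf_lim; exact: is_cvg_einfs.
have intL : (\int[nu]_z L z <= (K + fine alpha - 1)%:E)%E.
  by apply: (le_trans (fatou nu measurableT mPhiE PhiE0)); exact: limn_einf_le.
pose f (z : X * Y) : R := J z * ln (J z / (p z.1 * qt z.2)).
have mf : measurable_fun setT f.
  apply: measurable_funM => //; apply: (measurableT_comp (@measurable_ln R)).
  apply: measurable_fun_divr => //; first exact: measurable_funM.
  by move=> z; exact: mulr_ge0.
have mfE : measurable_fun setT (EFin \o f) by exact/measurable_EFinP.
(* Where [J a] vanishes, [f] is 0 through [ln 0 = 0] and division by 0; elsewhere f = - J ln a and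
   the pointwise limit applies. *)
have fL z : ((f z + J z * a z)%:E <= L z + (J z)%:E)%E.
  have [az|az] := eqVneq (J z * a z) 0.
    rewrite az addr0 (_ : f z = 0); first by rewrite adde_ge0// lee_fin.
    rewrite /f; have /eqP := az; rewrite mulf_eq0 => /orP[/eqP ->|]; first by rewrite mul0r.
    rewrite /a mulf_eq0 invr_eq0 => /orP[/eqP ->|/eqP qz].
      by rewrite mulr0 invr0 mulr0 ln0// mulr0.
    by rewrite /J qz mulr0 mul0r.
  have : J z * a z != 0 by [].
  rewrite mulf_eq0 negb_or => /andP[Jn an].
  have agt0 : 0 < a z by rewrite lt_neqAle eq_sym an a0.
  have fE : f z = J z * - ln (a z).
    rewrite /f; congr (_ * _); rewrite -lnV ?posrE//; congr ln.
    move: Jn an; rewrite /J /a !mulf_eq0 !negb_or invr_eq0 => /andP[pn qn] /andP[qtn _].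
    by field; rewrite pn qn qtn.
  have := oppr_ln_le_limn_einf (J z * a z - J z) agt0 (J0 z).
  rewrite -fE -/(L z) -leeBlDr// -EFinB => h.
  by rewrite -addrA.
(* As [f] need not be integrable, its positive and negative parts are put on opposite sides before
   integrating. *)
have key : (\int[nu]_z ((EFin \o f)^\+ z + (J z * a z)%:E) <=
   \int[nu]_z ((EFin \o f)^\- z + (L z + (J z)%:E)))%E.
  apply: ge0_le_integral => //.
  - by move=> z _; rewrite adde_ge0 ?funepos_ge0// lee_fin mulr_ge0.
  - apply: emeasurable_funD; first exact: measurable_funepos.
    exact/measurable_EFinP.
  - apply: emeasurable_funD; first exact: measurable_funeneg.
    by apply: emeasurable_funD => //; exact/measurable_EFinP.
  - move=> z _; have := fL z.
    have fzE : ((f z)%:E = (EFin \o f)^\+ z - (EFin \o f)^\- z)%E.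
      exact: (congr1 (@^~ z) (funeposneg (EFin \o f))).
    rewrite EFinD fzE.
    have fp : ((EFin \o f)^\+ z)%E \is a fin_num by rewrite funeposE /= -EFin_max.
    have fn : ((EFin \o f)^\- z)%E \is a fin_num by rewrite funenegE /= -EFin_max.
    rewrite -(fineK fp) -(fineK fn).
    case: (L z) (L0 z) => [l l0|_ _|]; last by rewrite leeNy_eq.
      by rewrite -!(EFinD, EFinN, EFinB) !lee_fin => h; lra.
    by rewrite addye// addey// leey.
move: key; rewrite ge0_integralD//; last 3 first.
- exact: measurable_funepos.
- by move=> z _; rewrite lee_fin mulr_ge0.
- exact/measurable_EFinP.
rewrite ge0_integralD//; last 3 first.
- exact: measurable_funeneg.
- by move=> z _; rewrite adde_ge0// lee_fin.
- by apply: emeasurable_funD => //; exact/measurable_EFinP.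
rewrite ge0_integralD//; last 2 first.
- by move=> z _; rewrite lee_fin.
- exact/measurable_EFinP.
rewrite int_J -/alpha => key.
suff : (\int[nu]_z (f z)%:E <= K%:E)%E by rewrite leNgt KI.
rewrite (integralE _ _ (fun z => (f z)%:E)).
have fp0 : (0 <= \int[nu]_z (EFin \o f)^\+ z)%E by exact: integral_ge0.
have fn0 : (0 <= \int[nu]_z (EFin \o f)^\- z)%E by exact: integral_ge0.
have iL0 : (0 <= \int[nu]_z L z)%E by exact: integral_ge0.
move: key fp0 fn0 iL0 intL; rewrite -(fineK alpha_fin).
rewrite -[(fun z => (f z)%:E)]/(EFin \o f).
case: (\int[nu]_z L z)%E => [l| |]//.
(* An infinite negative part makes the integral of [f] equal to -oo, even against an infinite
   positive part. *)
case: (\int[nu]_z (EFin \o f)^\- z)%E => [u| |]//; last first.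
  by rewrite addeNy leNye.
case: (\int[nu]_z (EFin \o f)^\+ z)%E => [w| |]//.
rewrite -!(EFinD, EFinN) !lee_fin => h _ _ _ h2; lra.
Qed.

(** The atom contributes at most 1 and the kernel at most (1 + e) / 2, and 1 - tau + tau (1 + e) / 2
    = 1 - tau (1 - e) / 2; the factor gam^s comes out of the integral. *)
Lemma chernoff_sparse x0 (tau : R) (P : probability X R) (s gam e : R) :
  0 <= tau <= 1 ->
  (forall A, measurable A -> P A = sparse_signalling muX x0 p tau A) ->
  0 < s <= 1 / 2 -> 0 < gam ->
  (\int[nu]_z (J z * a z `^ (2 * s))%:E <= e%:E)%E ->
  (\int[muY]_y \int[P]_x (q x y `^ (1 - s) *
     (gam * output_density_law P q y) `^ s)%:E <=
   (gam `^ s * (1 - tau / 2 * (1 - e)))%:E)%E.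
Proof.
move=> tau01 PE /andP[s0 s12] gam0 He.
have /andP[tau0 tau1] := tau01.
have [[mpY pY0 ipY] _] := is_density_output_law hq P.
set pY := output_density_law P q in mpY pY0 ipY *.
have gs0 : 0 <= gam `^ s by exact: powR_ge0.
pose h x y := q x y `^ (1 - s) * pY y `^ s.
have h0 x y : 0 <= h x y by rewrite mulr_ge0 ?powR_ge0.
have mpY2 : measurable_fun setT (fun z : X * Y => pY z.2).
  exact: (measurableT_comp mpY measurable_snd).
have mh : measurable_fun setT (fun z : X * Y => h z.1 z.2).
  apply: measurable_funM; first exact: (measurableT_comp (measurable_powR _) mq).
  exact: (measurableT_comp (measurable_powR _) mpY2).
have mhy y : measurable_fun setT (fun x => (h x y)%:E).
  by apply/measurable_EFinP; exact: (measurableT_comp mh (measurable_pair2 y)).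
have mhx x : measurable_fun setT (fun y => (h x y)%:E).
  by apply/measurable_EFinP; exact: (measurableT_comp mh (measurable_pair1 x)).
have mph : measurable_fun setT (fun z : X * Y => (h z.1 z.2 * p z.1)%:E).
  by apply/measurable_EFinP; exact: measurable_funM.
pose G y := (\int[muX]_x (h x y * p x)%:E)%E.
have mG : measurable_fun setT G.
  apply: (measurable_fun_fubini_tonelli_G _ mph) => z.
  by rewrite lee_fin mulr_ge0.
have G0 y : (0 <= G y)%E by apply: integral_ge0 => x _; rewrite lee_fin mulr_ge0.
have tau10 : 0 <= 1 - tau by lra.
have inner y : (\int[P]_x (q x y `^ (1 - s) * (gam * pY y) `^ s)%:E =
    (gam `^ s)%:E * ((1 - tau)%:E * (h x0 y)%:E + tau%:E * G y))%E.
  rewrite -(ge0_integral_sparse_signalling hp tau01 PE (mhy y)); last first.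
    by move=> x; rewrite lee_fin.
  rewrite -ge0_integralZl//; [|by move=> x _; rewrite lee_fin].
  apply: eq_integral => x _; rewrite -EFinM; congr EFin.
  by rewrite powRM ?(ltW gam0)// /h mulrCA.
under eq_integral do rewrite inner.
rewrite ge0_integralZl//; last 2 first.
- by apply: emeasurable_funD; exact: measurable_funeM.
- by move=> y _; rewrite adde_ge0// mule_ge0 ?lee_fin.
rewrite EFinM; apply: lee_wpmul2l; first by rewrite lee_fin.
rewrite ge0_integralD//; last 4 first.
- by move=> y _; rewrite mule_ge0 ?lee_fin.
- exact: measurable_funeM.
- by move=> y _; rewrite mule_ge0 ?lee_fin.
- exact: measurable_funeM.
rewrite !ge0_integralZl//; last by move=> y _; rewrite lee_fin.
have [mq0 _ iq0] := hq.2 x0.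

have first_le : (\int[muY]_y (h x0 y)%:E <= 1)%E.
  have -> : (1 = \int[muY]_y ((1 - s)%:E * (q x0 y)%:E + s%:E * (pY y)%:E))%E.
    rewrite ge0_integralD//; last 4 first.
    - by move=> y _; rewrite mule_ge0 ?lee_fin//; lra.
    - by apply: measurable_funeM; exact/measurable_EFinP.
    - by move=> y _; rewrite mule_ge0 ?lee_fin// ltW.
    - by apply: measurable_funeM; exact/measurable_EFinP.
    rewrite !ge0_integralZl//; try (exact/measurable_EFinP);
      try (by move=> y _; rewrite lee_fin); try (by rewrite lee_fin; lra).
    by rewrite iq0 ipY !mule1 -EFinD subrK.
  apply: ge0_le_integral => //.
  - by move=> y _; rewrite lee_fin.
  - by apply: emeasurable_funD; apply: measurable_funeM; exact/measurable_EFinP.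
  - move=> y _; rewrite -!EFinM -EFinD lee_fin; apply: powR_young => //.
    by apply/andP; split; lra.
have second_le : (\int[muY]_y G y <= (1 / 2 * e + 1 / 2)%:E)%E.
  rewrite /G -(fubini_tonelli2 (m1 := muX) (fun z => (h z.1 z.2 * p z.1)%:E))//; last first.
    by move=> z; rewrite lee_fin mulr_ge0.
  pose c y := pY y / qt y.
  have mc : measurable_fun setT c by exact: measurable_fun_divr.
  have c0 y : 0 <= c y by exact: divr_ge0.
  have mc2 : measurable_fun setT (fun z : X * Y => c z.2).
    exact: (measurableT_comp mc measurable_snd).
  have mJc : measurable_fun setT (fun z => (J z * c z.2)%:E).
    by apply/measurable_EFinP; exact: measurable_funM.
  (* Only an inequality, because the mass of [pY] on the zeros of [qt] is lost. *)
  have Jc1 : (\int[nu]_z (J z * c z.2)%:E <= 1)%E.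
    rewrite integral_J// -ipY; apply: ge0_le_integral => //.
    - by move=> y _; rewrite lee_fin mulr_ge0.
    - by apply/measurable_EFinP; exact: measurable_funM.
    - exact/measurable_EFinP.
    - move=> y _; rewrite lee_fin /c.
      have [->|qn] := eqVneq (qt y) 0; first by rewrite mulr0.
      by rewrite divfK.
  have mJa : measurable_fun setT (fun z => (J z * a z `^ (2 * s))%:E).
    apply/measurable_EFinP; apply: measurable_funM => //.
    exact: (measurableT_comp (measurable_powR _) ma).
  have mJE : measurable_fun setT (fun z => (J z)%:E) by exact/measurable_EFinP.
  (* Right-hand side of [powR_split_le] for u = q, t = qt, w = pY, multiplied by p. Its terms
     integrate to at most e / 2, (1 - 2 s) / 2 and s. *)
  pose B z := ((1 / 2)%:E * (J z * a z `^ (2 * s))%:E +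
    ((1 / 2 * (1 - 2 * s))%:E * (J z)%:E + s%:E * (J z * c z.2)%:E))%E.
  have k2 : 0 <= 1 / 2 * (1 - 2 * s) by lra.
  have Ja0 z : (0 <= (J z * a z `^ (2 * s))%:E)%E.
    by rewrite lee_fin mulr_ge0// powR_ge0.
  have JE0 z : (0 <= (J z)%:E)%E by rewrite lee_fin.
  have Jc0 z : (0 <= (J z * c z.2)%:E)%E by rewrite lee_fin mulr_ge0.
  have k10 : (0 <= (1 / 2)%:E :> \bar R)%E by rewrite lee_fin.
  have k20 : (0 <= (1 / 2 * (1 - 2 * s))%:E)%E by rewrite lee_fin.
  have s0E : (0 <= s%:E)%E by rewrite lee_fin ltW.
  apply: (@le_trans _ _ (\int[nu]_z B z)%E).
    apply: ae_ge0_le_integral => //.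
    - by move=> z _; rewrite lee_fin mulr_ge0.
    - by move=> z _; rewrite adde_ge0 ?adde_ge0 ?mule_ge0.
    - apply: emeasurable_funD; first exact: measurable_funeM.
      by apply: emeasurable_funD; exact: measurable_funeM.
    - apply: filterS J_qt0 => z Hz _; rewrite /B -!(EFinM, EFinD) lee_fin.
      (* At zeros of [qt] almost everywhere J = 0, so p or q vanishes and so do both sides. *)
      have [qz|qz] := eqVneq (qt z.2) 0.
        have Jz := Hz qz.
        rewrite Jz !(mul0r, mulr0, addr0).
        have /eqP := Jz; rewrite /J mulf_eq0 => /orP[/eqP ->|/eqP qq].
          by rewrite mulr0.
        by rewrite /h qq powR0 ?mul0r// subr_eq0 gt_eqF//; lra.
      have qtgt0 : 0 < qt z.2 by rewrite lt_neqAle eq_sym qz qt0.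
      have := powR_split_le (q0 z.1 z.2) qtgt0 (pY0 z.2) (_ : 0 < s <= 1 / 2).
      rewrite s0 s12 => /(_ isT) hle.
      rewrite mulrC; apply: (le_trans (ler_wpM2l (p0 z.1) hle)).
      rewrite le_eqVlt; apply/orP; left; apply/eqP.
      by rewrite /J /a /c; field.
  rewrite ge0_integralD//; last 4 first.
  - by move=> z _; rewrite mule_ge0.
  - exact: measurable_funeM.
  - by move=> z _; rewrite adde_ge0 ?mule_ge0.
  - by apply: emeasurable_funD; exact: measurable_funeM.
  rewrite ge0_integralD//; last 4 first.
  - by move=> z _; rewrite mule_ge0.
  - exact: measurable_funeM.
  - by move=> z _; rewrite mule_ge0.
  - exact: measurable_funeM.
  rewrite !ge0_integralZl//.
  rewrite int_J mule1.
  apply: (@le_trans _ _ ((1 / 2)%:E * e%:E + ((1 / 2 * (1 - 2 * s))%:E + s%:E * 1))%E).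
    by rewrite leeD// ?lee_wpmul2l// leeD2l// lee_wpmul2l.
  by rewrite mule1 -!(EFinM, EFinD) lee_fin; lra.
apply: (@le_trans _ _ ((1 - tau)%:E * 1 + tau%:E * (1 / 2 * e + 1 / 2)%:E)%E).
  by apply: leeD; apply: lee_wpmul2l => //; rewrite lee_fin.
by rewrite mule1 -!(EFinM, EFinD) lee_fin; lra.
Qed.

End exponent.

(** * Achievability *)

Lemma lte_fin_between (R : realType) (y : R) (x : \bar R) :
  (y%:E < x)%E -> exists2 z, y < z & (z%:E < x)%E.
Proof.
case: x => [x| _|//].
  rewrite lte_fin => yx; exists ((y + x) / 2); first by rewrite midf_lt.
  by rewrite lte_fin midf_lt.
by exists (y + 1); rewrite ?ltrDl ?ltr01// ltry.
Qed.

Lemma near_lt_sqrt (R : realType) (A : R) :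
  \forall n \near \oo, A < Num.sqrt n%:R.
Proof.
near=> n.
have An : A ^+ 2 < n%:R by near: n; exact: nbhs_infty_gtr.
rewrite (le_lt_trans (ler_norm A))// -sqrtr_sqr ltr_sqrt//.
by rewrite (le_lt_trans _ An)// sqr_ge0.
Unshelve. all: by end_near. Qed.

Section single_codeword.
Context dX dY (X : measurableType dX) (Y : measurableType dY) (R : realType).
Variables (muY : {sigma_finite_measure set Y -> \bar R}) (q : X -> Y -> R).

(** A single message is never decoded wrongly, so the good codes fill the ensemble, which has mass
    one. This provides a size available at every length. *)
Lemma exist_in_ensemble1 (P : probability X R) (n : nat) (eps : R) : 0 <= eps ->
  exist_in_ensemble P (fun C : codebook X 1 n => decodable muY q eps C).
Proof.
move=> eps0.
have good C : decodable muY q eps (C : codebook X 1 n).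
  exists (fun=> ord0).
    move=> m; rewrite (_ : [set _ | _] = setT)//.
    by apply/seteqP; split => // y _ /=; rewrite (ord1 m).
  rewrite /average_error_prob big_ord1 /error_prob.
  rewrite (_ : [set _ | _] = set0) ?integral_set0 ?mule0 ?lee_fin//.
  by apply/seteqP; split => // y /=.
move=> [N [mN N0 subN]].
have NT : N = setT by apply/seteqP; split => // C _; apply: subN => /=; exact: good.
have P1 : (P setT = 1)%E := probability_setT P.
have := tuple_measure_setT 1 (tuple_measure_setT n P1).
rewrite -NT [X in X = _ -> _]N0 => /esym/eqP.
by rewrite eqe oner_eq0.
Qed.

End single_codeword.

Section achievability.
Context dX dY (X : measurableType dX) (Y : measurableType dY) (R : realType).
Variables (muX : {sigma_finite_measure set X -> \bar R})
  (muY : {sigma_finite_measure set Y -> \bar R}) (q : X -> Y -> R)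
  (p : X -> R) (x0 : X).
Hypotheses (hq : is_channel muY q) (hp : is_density muX p).
Variables (c eps : R) (tau : nat -> R) (P : nat -> probability X R).
Hypotheses (c0 : 0 < c) (eps0 : 0 < eps).
Hypothesis tauE : forall n, tau n = c / Num.sqrt n%:R.
Hypothesis hP : \forall n \near \oo, forall A : set X, measurable A ->
  P n A = sparse_signalling muX x0 p (tau n) A.

Let ntau n : n%:R * tau n = c * Num.sqrt n%:R.
Proof.
have [->|n0] := eqVneq n 0%N; first by rewrite sqrtr0 !(mul0r, mulr0).
have s0 : 0 < Num.sqrt n%:R :> R by rewrite sqrtr_gt0 ltr0n lt0n.
rewrite tauE -[X in X * _]sqr_sqrtr ?ler0n//.
by field; rewrite gt_eqF.
Qed.

Lemma near_tau01 : \forall n \near \oo, 0 < tau n <= 1.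
Proof.
near=> n.
have sn : c < Num.sqrt n%:R by near: n; exact: near_lt_sqrt.
have s0 := lt_trans c0 sn.
by rewrite tauE divr_gt0// ler_pdivrMr// mul1r ltW.
Unshelve. all: by end_near. Qed.

Let near_expR_lt (d e : R) : 0 < d -> 0 < e ->
  \forall n \near \oo, expR (- (n%:R * tau n * d)) < e.
Proof.
move=> d0 e0; near=> n.
have sn : (- ln e) / (c * d) < Num.sqrt n%:R by near: n; exact: near_lt_sqrt.
rewrite -[ltRHS]lnK ?posrE// ltr_expR ltrNl ntau mulrAC -ltr_pdivrMl ?mulr_gt0//.
by rewrite mulrC.
Unshelve. all: by end_near. Qed.

(** Two intermediate rates K < K2 < K1 are inserted below the mutual information: [K1] yields the
    Chernoff exponent and [K2] sets the threshold. The gap K1 - K2 makes the missed-threshold term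
    decay, the gap K2 - K the union bound. *)
Lemma near_exist_in_ensemble (K : R) :
  0 <= K -> (K%:E < mutual_information muX muY p q)%E ->
  \forall n \near \oo, exist_in_ensemble (P n)
    (fun C : codebook X (Num.truncn (expR (n%:R * tau n * K))).+1 n =>
       decodable muY q eps C).
Proof.
move=> K0 KI.
have [K2 K2K K2I] := lte_fin_between KI.
have [K1 K12 K1I] := lte_fin_between K2I.
have [r /andP[r0 r1] Hr] := mutual_information_limit hq hp K1I.
pose s := r / 2.
have s0 : 0 < s by rewrite divr_gt0.
have d0 : 0 < s * (K1 - K2) by rewrite mulr_gt0// subr_gt0.
have d1 : 0 < K2 - K by rewrite subr_gt0.
have K20 : 0 < K2 by exact: le_lt_trans K0 K2K.
(* One third for the Chernoff term, one for the union bound with e^(n tau K) words, one for the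
   extra word due to rounding up. *)
have e3 : 0 < eps / 3 by rewrite divr_gt0.
near=> n.
have PE : forall A : set X, measurable A ->
    P n A = sparse_signalling muX x0 p (tau n) A by near: n.
have /andP[t0 t1] : 0 < tau n <= 1 by near: n; exact: near_tau01.
have h0 : expR (- (n%:R * tau n * (s * (K1 - K2)))) < eps / 3.
  by near: n; exact: near_expR_lt.
have h1 : expR (- (n%:R * tau n * (K2 - K))) < eps / 3.
  by near: n; exact: near_expR_lt.
have h2 : expR (- (n%:R * tau n * K2)) < eps / 3.
  by near: n; exact: near_expR_lt.
pose gam := expR (tau n * K2).
have gam0 : 0 < gam := expR_gt0 _.
have s01 : 0 < s < 1 by rewrite s0 /s; lra.
have s12 : 0 < s <= 1 / 2 by rewrite s0 /s; lra.
apply: (exist_in_ensemble_threshold hq s01 gam0).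
have t01 : 0 <= tau n <= 1 by rewrite ltW.
have Hs : (\int[(muX \x muY)%E]_z (p z.1 * q z.1 z.2 *
    (output_density muX p q z.2 / q z.1 z.2) `^ (2 * s))%:E <= (1 - r * K1)%:E)%E.
  by rewrite /s mulrC divfK// pnatr_eq0.
have HB := chernoff_sparse hq hp t01 PE s12 gam0 Hs.
have gsE : gam `^ s = expR (tau n * K2 * s) by rewrite expRM.
set S := (\int[muY]_y _)%E in HB *.
have S0 : (0 <= S)%E.
  apply: integral_ge0 => y _; apply: integral_ge0 => x _.
  by rewrite lee_fin mulr_ge0 ?powR_ge0.
have Sfin : S \is a fin_num by rewrite ge0_fin_numE// (le_lt_trans HB)// ltry.
move: HB S0; rewrite -(fineK Sfin) -EFin_expe -EFinD !lee_fin lte_fin.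
move: (fine S) => {S Sfin} S HB S0.
(* With s = r / 2 the Chernoff bound is e^(tau K2 s) (1 - tau s K1), and 1 - u <= e^-u. *)
have Sn : S ^+ n <= expR (- (n%:R * tau n * (s * (K1 - K2)))).
  rewrite -mulrA -mulrN expRM_natl lerXn2r ?nnegrE ?expR_ge0//.
  apply: (le_trans HB); rewrite gsE.
  have -> : - (tau n * (s * (K1 - K2))) = tau n * K2 * s + - (tau n * s * K1) by ring.
  rewrite expRD ler_pM2l ?expR_gt0//; apply: (le_trans _ (expR_ge1Dx _)).
  by rewrite le_eqVlt; apply/orP; left; apply/eqP; rewrite /s; field.
have Mn : (Num.truncn (expR (n%:R * tau n * K))).+1%:R * gam ^- n <=
    expR (- (n%:R * tau n * (K2 - K))) + expR (- (n%:R * tau n * K2)).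
  have -> : gam ^- n = expR (- (n%:R * tau n * K2)).
    by rewrite /gam -expRM_natl -expRN mulrA.
  have -> : expR (- (n%:R * tau n * (K2 - K))) =
      expR (n%:R * tau n * K) * expR (- (n%:R * tau n * K2)).
    by rewrite -expRD; congr expR; ring.
  rewrite -[X in _ + X]mul1r -mulrDl ler_pM2r ?expR_gt0//.
  by rewrite -addn1 natrD lerD2r truncn_le// expR_ge0.
lra.
Unshelve. all: by end_near. Qed.

Let good n M := (0 < M)%N /\
  exist_in_ensemble (P n) (fun C : codebook X M n => decodable muY q eps C).

(* The cap exp n only serves to make the maximum well defined: M n is optimal
   among the admissible code sizes, so that one sequence works for all rates
   below the mutual information. *)
Lemma achievable_code_sizes : exists M : nat -> nat,
  [/\ forall n, good n (M n) &
      forall K, 0 <= K -> (K%:E < mutual_information muX muY p q)%E ->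
        \forall n \near \oo, expR (c * Num.sqrt n%:R * K) <= (M n)%:R].
Proof.
pose B n := (Num.truncn (expR n%:R : R)).+2.
pose A n := [pred m : 'I_(B n) | `[< good n m >]].
pose M n := \max_(m in A n) m.
have good1 n : good n 1 by split => //; apply: exist_in_ensemble1; exact: ltW.
exists M; split => [n|K K0 KI].
  (* Size 1 is always good, so the maximum is over a nonempty set and is attained. *)
  have : (0 < #|A n|)%N.
    apply/card_gt0P; exists (Ordinal (isT : (1 < B n)%N)).
    by rewrite inE /=; exact: good1.
  move=> /(eq_bigmax_cond (fun m : 'I_(B n) => m : nat))[m gm Mm].
  by move: gm; rewrite inE /M Mm.
near=> n.

have sn : c * K < Num.sqrt n%:R by near: n; exact: near_lt_sqrt.
have : good n (Num.truncn (expR (n%:R * tau n * K))).+1.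
  by split => //; near: n; exact: near_exist_in_ensemble.
set m := _.+1 => gm.
(* Once c K < sqrt n, the exponent c K sqrt n is at most n, and the desired size lies below the
   cap. *)
have mB : (m < B n)%N.
  rewrite ltnS /m ltnS; apply: le_truncn; rewrite ler_expR ntau mulrAC.
  rewrite -[leRHS]sqr_sqrtr ?ler0n// expr2.
  by apply: ler_wpM2r; rewrite ?sqrtr_ge0// ltW.
have mM : (m <= M n)%N.
  apply: (@leq_bigmax_cond _ (A n) (fun i : 'I_(B n) => i : nat) (Ordinal mB)).
  by rewrite inE.
rewrite -ntau; apply: (@le_trans _ _ m%:R); last by rewrite ler_nat.
by rewrite ltW// truncnS_gt.
Unshelve. all: by end_near. Qed.

End achievability.

(** * Detection, decoding and rate combined *)

Theorem corollary2 (R : realType) (dX dY dW : measure_display)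
  (X : measurableType dX) (Y : measurableType dY) (W : measurableType dW)
  (muX : {sigma_finite_measure set X -> \bar R})
  (muY : {sigma_finite_measure set Y -> \bar R})
  (muW : {sigma_finite_measure set W -> \bar R})
  (pYX : X -> Y -> R) (hpYX : is_channel muY pYX)
  (pWX : X -> W -> R) (hpWX : is_channel muW pWX)
  (x0 : X) (pXt : X -> R) (hpXt : is_density muX pXt)
  (chi : \bar R)
  (hchi : chi = chi2 muW (output_density muX pXt pWX) (pWX x0))
  (hchi_gt0 : (0 < chi)%E) (hchi_fin : (chi < +oo)%E)
  (eps_det eps_dec : R)
  (heps_det : 0 < eps_det < 1) (heps_dec : 0 < eps_dec < 1)
  (xi : R) (hxi : xi = expR (- (1 / 2) * lambertW0 (4 * eps_det ^+ 2)))
  (tau : nat -> R)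
  (htau : forall n, tau n = 2 * xi * eps_det / Num.sqrt (n%:R * fine chi))
  (PX : nat -> probability X R)
  (hPX : \forall n \near \oo, forall A : set X, measurable A ->
     PX n A = sparse_signalling muX x0 pXt (tau n) A)
  (hdomW : \forall n \near \oo,
     dominated_density (output_density_law (PX n) pWX) (pWX x0))
  (hdomY : \forall n \near \oo,
     dominated_density (output_density_law (PX n) pYX) (pYX x0)) :
  exists M : nat -> nat,
    [/\ \forall n \near \oo,
          (0 < M n)%N /\
          exist_in_ensemble (PX n)
            (fun C : codebook X (M n) n => decodable muY pYX eps_dec C),
        \forall n \near \oo,
          detection_prob_le muW (pWX x0) (output_density_law (PX n) pWX)
            n eps_det
      & ((2 * xi / ln 2)%:E *
           (mutual_information muX muY pXt pYX
            * ((Num.sqrt (fine chi))^-1)%:E)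
         <= limn_einf (fun n : nat =>
              (log2 (M n)%:R / (eps_det * Num.sqrt n%:R))%:E))%E].
Proof.
set chir := fine chi.
have chir_gt0 : 0 < chir by apply: fine_gt0; rewrite hchi_gt0.
have /andP[ed0 ed1] := heps_det; have /andP[ec0 ec1] := heps_dec.
have xi0 : 0 < xi by rewrite hxi expR_gt0.
have schi0 : 0 < Num.sqrt chir by rewrite sqrtr_gt0.
(* Chosen so that [tau n] is c / sqrt n; moreover c / (eps_det ln 2) is the coefficient of the
   mutual information in the claim, [kc] below. *)
pose c := 2 * xi * eps_det / Num.sqrt chir.
have c0 : 0 < c by rewrite divr_gt0// !mulr_gt0.
have tauE n : tau n = c / Num.sqrt n%:R.
  by rewrite htau sqrtrM ?ler0n// invfM mulrCA mulrC.
(* The left-hand side is n tau^2 times chi-squared, the quantity that detection requires to be this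
   Lambert value. *)
have xi2 : xi ^+ 2 * (4 * eps_det ^+ 2) = lambertW0 (4 * eps_det ^+ 2).
  have wE : lambertW0 (4 * eps_det ^+ 2) * expR (lambertW0 (4 * eps_det ^+ 2)) =
      4 * eps_det ^+ 2 by apply: lambertW0P; rewrite mulr_ge0// sqr_ge0.
  rewrite -[X in _ * X = _]wE hxi; set w := lambertW0 _; rewrite -expRM_natl mulrCA -expRD.
  by rewrite (_ : _ + _ = 0) ?expR0 ?mulr1//; field.
have [M [Mgood Mrate]] := achievable_code_sizes hpYX hpXt c0 ec0 tauE hPX.
exists M; split.
- exact: nearW.
- have t01 := near_tau01 c0 tauE.
  near=> n.
  have n0 : (0 < n)%N by near: n; exact: nbhs_infty_gt.
  have PE : forall A : set X, measurable A ->
     PX n A = sparse_signalling muX x0 pXt (tau n) A by near: n.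
  apply: (@detection_prob_le_sparse _ _ _ _ _ muX muW pWX pXt x0 (PX n) (tau n)).
  + by [].
  + by [].
  + by near: n.
  + by [].
  + exact: PE.
  + by near: n.
  + by rewrite -hchi.
  rewrite -hchi -/chir -xi2 tauE.
  have sn0 : 0 < Num.sqrt n%:R :> R by rewrite sqrtr_gt0 ltr0n.
  rewrite -[X in X * _ * _](sqr_sqrtr (ler0n R n)).
  rewrite -[X in _ * X = _](sqr_sqrtr (ltW chir_gt0)) /c.
  by field; rewrite !gt_eqF.
set L := limn_einf _.
have ln20 : 0 < ln 2 :> R by rewrite ln_gt0// ltr1n.
(* This settles the case I <= 0, and otherwise makes the rate l / kc below nonnegative. *)
have L0 : (0 <= L)%E.
  apply: limn_einf_ge; apply: nearW => n; rewrite lee_fin.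
  have [M0 _] := Mgood n.
  apply: divr_ge0; last by rewrite mulr_ge0 ?sqrtr_ge0 ?ltW.
  by apply: divr_ge0; [rewrite ln_ge0// ler1n|exact: ltW].
set I := mutual_information _ _ _ _.
set k := 2 * xi / ln 2.
have k0 : 0 < k by rewrite divr_gt0// mulr_gt0.
pose kc := k / Num.sqrt chir.
have kc0 : 0 < kc by rewrite divr_gt0.
have -> : (k%:E * (I * ((Num.sqrt chir)^-1)%:E) = kc%:E * I)%E.
  by rewrite [(I * _)%E]muleC muleA -EFinM.
have rate K : 0 <= K -> (K%:E < I)%E -> ((kc * K)%:E <= L)%E.
  move=> K0 KI; apply: limn_einf_ge.
  have MK := Mrate _ K0 KI.
  near=> n.
  have n0 : (0 < n)%N by near: n; exact: nbhs_infty_gt.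
  have Mn : expR (c * Num.sqrt n%:R * K) <= (M n)%:R by near: n.
  have sn0 : 0 < Num.sqrt n%:R :> R by rewrite sqrtr_gt0 ltr0n.
  have lnM : c * Num.sqrt n%:R * K <= ln (M n)%:R.
    rewrite -[leLHS]expRK ler_ln ?posrE ?expR_gt0//.
    exact: (lt_le_trans (expR_gt0 _) Mn).
  rewrite lee_fin ler_pdivlMr ?mulr_gt0// /log2 ler_pdivlMr//.
  apply: le_trans lnM; rewrite le_eqVlt; apply/orP; left; apply/eqP.
  by rewrite /kc /k /c; field; rewrite !gt_eqF.
have [I0|I0] := leP I 0%E.
  by apply: le_trans L0; rewrite mule_ge0_le0// lee_fin ltW.
(* Otherwise L is a finite l with l / kc < I, and any rate K strictly in between contradicts [rate].
   This covers infinite I as well. *)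
rewrite leNgt; apply/negP => LI.
have Lfin : L \is a fin_num.
  by rewrite ge0_fin_numE// (lt_le_trans LI)// leey.
move: L0 LI rate; rewrite -(fineK Lfin); move: (fine L) => l l0 LI rate.
rewrite lee_fin in l0.
have lI : ((l / kc)%:E < I)%E.
  move: LI; case: I {I0 rate} => [x| |].
  - by rewrite -EFinM !lte_fin ltr_pdivrMr// mulrC.
  - by rewrite ltry.
  - by rewrite mulrNy gtr0_sg// mul1e.
have [K lK KI] := lte_fin_between lI.
have K0 : 0 <= K by rewrite (le_trans _ (ltW lK))// divr_ge0// ltW.
have := rate K K0 KI; rewrite lee_fin leNgt => /negP; apply.
by rewrite mulrC -ltr_pdivrMr.
Unshelve. all: by end_near. Qed.
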